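(* If $G$ is a residually finite geometrically rigid hyperbolic group, then the outer automorphism group $\mathrm{Out}(G)$ is finite.
   Context: A hyperbolic (Gromov/word-hyperbolic) group $G$ is geometrically rigid if it is one-ended and its Gromov boundary $\partial G$ contains no cut pair, i.e. no two distinct points $a,b$ such that $\partial G\setminus\{a,b\}$ is disconnected. *)

(* Defs.v *)
From HB Require Import structures.
From mathcomp Require Import all_boot all_order all_algebra all_fingroup.
From mathcomp Require Import boolp classical_sets functions cardinality.
From mathcomp Require Import topology.

Set Implicit Arguments.
Unset Strict Implicit.
Unset Printing Implicit Defensive.

Import Order.TTheory GRing.Theory Num.Theory.

Local Open Scope classical_set_scope.
Local Open Scope group_scope.

Section CayleyGraph.
Variables (G : groupType) (S : seq G).

Definition letters : seq G := S ++ [seq s^-1 | s <- S].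

Definition spelled_by (g : G) (w : seq G) : Prop :=
  {subset w <= letters} /\ \prod_(x <- w) x = g.

Definition generating : Prop := forall g : G, exists w, spelled_by g w.

(* Takes the junk value 0 outside the subgroup generated by [S]. *)
Definition word_length (g : G) : nat :=
  xget 0%N [set n : nat | (exists2 w, spelled_by g w & size w = n) /\
                          forall w, spelled_by g w -> (n <= size w)%N].

Definition word_dist (x y : G) : rat := (word_length (x^-1 * y))%:R%R.

Definition gromov_product (o x y : G) : rat :=
  ((word_dist o x + word_dist o y - word_dist x y) / 2%:R)%R.

(* Gromov's four-point condition; the vertex set is 1-dense in the Cayley graph,
   so this amounts to hyperbolicity of the Cayley graph as a geodesic space. *)
Definition gromov_hyperbolic : Prop :=
  exists delta : rat, forall o x y z : G,
    (Order.min (gromov_product o x y) (gromov_product o y z) - delta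
       <= gromov_product o x z)%R.

Definition cayley_adj (x y : G) : bool := x^-1 * y \in letters.

(* The vertices joined to [x] by an edge path of the Cayley graph none of whose
   vertices, [x] included, lies in [K]. *)
Definition component_off (K : seq G) (x : G) : set G :=
  [set y | exists p : seq G, [/\ path cayley_adj x p,
                                 all (fun v => v \notin K) (x :: p) &
                                 last x p = y]].

(* The Cayley graph is locally finite: a component is unbounded iff it is
   infinite. *)
Definition unbounded_component (K : seq G) (C : set G) : Prop :=
  (exists2 x, x \notin K & C = component_off K x) /\ infinite_set C.

Definition one_ended : Prop :=
  forall K : seq G, exists! C : set G, unbounded_component K C.

(* Gromov products are half-integers, so [r <= liminf_(i, j) (x_i | y_j)] holds
   iff the inequality holds for all large [i] and [j]. *)
Definition liminf_product_ge (x y : nat -> G) (r : rat) : Prop :=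
  exists N : nat, forall i j : nat, (N <= i)%N -> (N <= j)%N ->
    (r <= gromov_product 1%g (x i) (y j))%R.

Definition converges_to_infinity (x : nat -> G) : Prop :=
  forall r : rat, liminf_product_ge x x r.

Definition same_endpoint (x y : nat -> G) : Prop :=
  forall r : rat, liminf_product_ge x y r.

Definition endpoint (x : nat -> G) : set (nat -> G) :=
  [set y | converges_to_infinity y /\ same_endpoint x y].

Definition gromov_boundary : Type :=
  {p : set (nat -> G) | p \in endpoint @` converges_to_infinity}.

HB.instance Definition _ := Choice.on gromov_boundary.

(* The points [q] with [r <= sup liminf_(i, j) (x_i | y_j)], the supremum over
   the sequences representing [p] and [q]. *)
Definition boundary_nbhd (p : gromov_boundary) (r : rat) : set gromov_boundary :=
  [set q | exists x y, [/\ val p x, val q y & liminf_product_ge x y r]].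

(* The topology in which the sets [boundary_nbhd p r] form a neighbourhood basis
   at [p] when the group is hyperbolic. *)
Definition boundary_open (A : set gromov_boundary) : Prop :=
  forall p, A p -> exists r : rat, boundary_nbhd p r `<=` A.

Lemma boundary_nbhd_le p r r' :
  (r <= r')%R -> boundary_nbhd p r' `<=` boundary_nbhd p r.
Proof.
move=> rr' q [x [y [px qy [N xy]]]]; exists x, y; split=> //; exists N => i j Ni Nj.
exact: le_trans rr' (xy i j Ni Nj).
Qed.

Lemma boundary_openT : boundary_open setT.
Proof. by move=> p _; exists 0%R. Qed.

Lemma boundary_openI : setI_closed boundary_open.
Proof.
move=> A B oA oB p [/oA[r rA] /oB[r' rB]]; exists (Order.max r r') => q q_near.
split; [apply: rA|apply: rB]; apply: boundary_nbhd_le q_near.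
  by rewrite le_max lexx.
by rewrite le_max lexx orbT.
Qed.

Lemma boundary_open_bigU (I : Type) (f : I -> set gromov_boundary) :
  (forall i, boundary_open (f i)) -> boundary_open (\bigcup_i f i).
Proof.
move=> of_ p [i _ fip]; have [r rf] := of_ i p fip.
by exists r => q /rf fiq; exists i.
Qed.

HB.instance Definition _ := isOpenTopological.Build gromov_boundary
  boundary_openT boundary_openI boundary_open_bigU.

Definition cut_pair (a b : gromov_boundary) : Prop :=
  a <> b /\ ~ connected (~` [set a; b]).

End CayleyGraph.

Definition hyperbolic_group (G : groupType) : Prop :=
  exists S : seq G, generating S /\ gromov_hyperbolic S.

(* For hyperbolic groups neither the number of ends nor the topological space
   [gromov_boundary S] depends on the finite generating set [S]. *)
Definition geometrically_rigid (G : groupType) : Prop :=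
  exists S : seq G, [/\ generating S, one_ended S &
    ~ exists a b : gromov_boundary S, cut_pair a b].

Definition residually_finite (G : groupType) : Prop :=
  forall g : G, g != 1 ->
    exists (H : finGroupType) (f : {multiplicative G -> H}), f g != 1.

Section OuterAutomorphisms.
Variable G : groupType.

Definition automorphism : set (G -> G) :=
  [set f | {morph f : x y / x * y} /\ bijective f].

Definition inner : set (G -> G) := [set (fun x => x ^ c) | c in [set: G]].

(* Out(G) = Aut(G) / Inn(G), as the set of cosets of Inn(G). *)
Definition Out : set (set (G -> G)) :=
  [set [set i \o f | i in inner] | f in automorphism].

End OuterAutomorphisms.
Arguments Out G : clear implicits.

(* Main.v *)
(* Fix an automorphism [phi]. At every point [x] of [G], each far point is seen
   in one of finitely many directions. Residual finiteness colors [G] by a finite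
   group so that nearby points have distinct colors; greedy choices of colors
   yield an equivariant system of directions for which the following 1-cochain
   fails to be closed only at a number of points bounded independently of [phi]
   and [x]: it counts the signed crossings, from one given direction at [x] to
   another, of the images by [phi] of the pairs of nearby points. Because the
   boundary has no cut pair, paths can be pushed to infinity away from few given
   points; so the sum of such a cochain along a bi-infinite line vanishes unless
   the line passes within a bounded distance of one of them. If [|phi(g)^2|] were
   much larger than [|phi(g)|] for some [g] with [|g| <= 2], then every [x] in the
   middle of a geodesic from [1] to [phi(g)] would give a cochain with sum 1 along
   the powers of [g], and distinct [x] would need distinct exceptional points,
   which are too few. Thus [|phi(g)^2| - |phi(g)|] is bounded uniformly in [phi];
   applied to the generators and to their products, this bounds the displacement
   of [phi] on the generators up to an inner automorphism, which leaves finitely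
   many outer classes. *)
From mathcomp Require Import all_boot all_order all_algebra all_fingroup zify.
From mathcomp Require Import boolp classical_sets cardinality topology.
Require Import Defs.

Set Implicit Arguments.
Unset Strict Implicit.
Unset Printing Implicit Defensive.

Local Open Scope group_scope.

(** * Word metrics *)

(** The quantity [|a^2| - |a|] is used because in a tree it is the translation length of a
    hyperbolic [a] and is at most 0 for an elliptic one. It is bounded for generators and their
    pairwise products in view of Serre's lemma: elliptic elements with elliptic pairwise products
    have a common fixed point, of which a coarse form is proved. No limit tree is formed, so every
    constant must be fixed before [phi]; the support of a cochain may depend on [phi], but the
    number of points where it is not closed may not. Cut pairs enter because a finite set, seen from
    a point far from it and from the centers of its triples, lies in at most two directions. If
    paths could not be led around such sets uniformly, a limit would yield two boundary points that
    separate, or a single one, completed by another. The hypotheses supply one generating set for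
    hyperbolicity and another for rigidity, so hyperbolicity has to be carried from one to the other
    by the Morse lemma. *)

Section WordMetric.
Variables (G : groupType) (S : seq G).

Definition dist (x y : G) : nat := word_length S (x^-1 * y).

(* Twice the Gromov product, so as to stay among the natural numbers. *)
Definition gp2 (o x y : G) : nat := (dist o x + dist o y - dist x y)%N.

Hypothesis gS : generating S.

Lemma word_lengthP g :
  (exists2 w, spelled_by S g w & size w = word_length S g) /\
  forall w, spelled_by S g w -> (word_length S g <= size w)%N.
Proof.
rewrite /word_length; case: xgetP => [n -> // | noP]; exfalso.
have [w sw] := gS g.
pose P n := `[< exists2 w, spelled_by S g w & size w = n >].
have exP : exists n, P n by exists (size w); apply/asboolP; exists w.
case: (ex_minnP exP) => m /asboolP Pm minm; apply: (noP m); split=> // w' sw'.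
by apply: minm; apply/asboolP; exists w'.
Qed.

Lemma lettersV x : x \in letters S -> x^-1 \in letters S.
Proof.
rewrite !mem_cat => /orP[xS|/mapP[s sS ->]]; last by rewrite invgK sS.
by apply/orP; right; apply/mapP; exists x.
Qed.

Lemma spelled1 : spelled_by S 1 [::].
Proof. by split=> //; rewrite big_nil. Qed.

Lemma spelledM g h v w :
  spelled_by S g v -> spelled_by S h w -> spelled_by S (g * h) (v ++ w).
Proof.
move=> [sv <-] [sw <-]; split; last by rewrite big_cat.
by move=> x; rewrite mem_cat => /orP[/sv|/sw].
Qed.

Lemma spelledV g w : spelled_by S g w -> spelled_by S g^-1 (rev [seq x^-1 | x <- w]).
Proof.
move=> [sw <-]; split.
  by move=> x; rewrite mem_rev => /mapP[y /sw yl ->]; apply: lettersV.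
elim: w {sw} => [|x w IHw]; first by rewrite !big_nil invg1.
by rewrite /= rev_cons -cats1 big_cat /= IHw big_cons big_nil mulg1 big_cons invgM.
Qed.

Lemma word_length_le g w : spelled_by S g w -> (word_length S g <= size w)%N.
Proof. exact: (word_lengthP g).2. Qed.

Lemma word_length1 : word_length S 1 = 0%N.
Proof. by apply/eqP; rewrite -leqn0; apply: (word_length_le spelled1). Qed.

Lemma word_length_eq0 g : word_length S g = 0%N -> g = 1.
Proof.
by have [[w [_ <-] <-] _] := word_lengthP g; move/size0nil=> ->; rewrite big_nil.
Qed.

Lemma word_lengthM g h :
  (word_length S (g * h) <= word_length S g + word_length S h)%N.
Proof.
have [[v sv <-] _] := word_lengthP g; have [[w sw <-] _] := word_lengthP h.
by rewrite -size_cat; apply/word_length_le/spelledM.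
Qed.

Lemma word_lengthV g : word_length S g^-1 = word_length S g.
Proof.
have le h : (word_length S h^-1 <= word_length S h)%N.
  have [[w /spelledV sw <-] _] := word_lengthP h.
  by apply: leq_trans (word_length_le sw) _; rewrite size_rev size_map.
by apply/eqP; rewrite eqn_leq le -{1}[g]invgK le.
Qed.

Lemma word_length_split g i : (i <= word_length S g)%N ->
  exists h k, [/\ g = h * k, word_length S h = i & word_length S k = (word_length S g - i)%N].
Proof.
have [[w [sw defg] szw] _] := word_lengthP g; move=> ile.
exists (\prod_(x <- take i w) x), (\prod_(x <- drop i w) x).
have s1 : spelled_by S (\prod_(x <- take i w) x) (take i w).
  by split=> // x /mem_take/sw.
have s2 : spelled_by S (\prod_(x <- drop i w) x) (drop i w).
  by split=> // x /mem_drop/sw.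
have gE : g = \prod_(x <- take i w) x * \prod_(x <- drop i w) x.
  by rewrite -big_cat cat_take_drop.
have := word_length_le s1; have := word_length_le s2.
have := word_lengthM (\prod_(x <- take i w) x) (\prod_(x <- drop i w) x).
rewrite -gE size_drop size_takel ?szw // => lm l2 l1; split=> //; lia.
Qed.

Lemma dist_mul g x y : dist (g * x) (g * y) = dist x y.
Proof. by rewrite /dist invgM -mulgA mulKg. Qed.

Lemma dist1 x : dist 1 x = word_length S x.
Proof. by rewrite /dist invg1 mul1g. Qed.

Lemma dist_mulr x y : dist x (x * y) = dist 1 y.
Proof. by rewrite dist1 /dist mulKg. Qed.

Lemma distxx x : dist x x = 0%N.
Proof. by rewrite /dist mulVg word_length1. Qed.

Lemma dist_eq0 x y : dist x y = 0%N -> x = y.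
Proof. by move/word_length_eq0/mulg1_eq; rewrite invgK. Qed.

Lemma distC x y : dist x y = dist y x.
Proof. by rewrite /dist -word_lengthV invgM invgK. Qed.

Lemma dist_tri x y z : (dist x z <= dist x y + dist y z)%N.
Proof.
apply: leq_trans (word_lengthM (x^-1 * y) (y^-1 * z)).
by rewrite mulgA mulgK.
Qed.

Lemma dist_split x y i : (i <= dist x y)%N ->
  exists z, dist x z = i /\ dist z y = (dist x y - i)%N.
Proof.
move=> /word_length_split[h [k [xyE hi ki]]]; exists (x * h).
split; first by rewrite /dist mulKg.
by rewrite /dist invgM -mulgA {1}xyE mulKg.
Qed.

Lemma ball_finite n : exists s : seq G, forall x, (word_length S x <= n)%N -> x \in s.
Proof.
elim: n => [|n [s sP]].
  by exists [:: 1] => x; rewrite leqn0 => /eqP/word_length_eq0 ->; rewrite mem_head.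
exists (s ++ [seq x * l | x <- s, l <- letters S]) => x.
rewrite leq_eqVlt => /orP[/eqP xn|xn]; last by rewrite mem_cat sP.
rewrite mem_cat; apply/orP; right.
have [[w [sw defx] szw] _] := word_lengthP x.
case/lastP: w => [|w l] in sw defx szw; first by rewrite xn in szw.
apply/allpairsP; exists (\prod_(y <- w) y, l); rewrite /= -defx big_rcons.
split=> //; last by apply: sw; rewrite mem_rcons mem_head.
apply: sP; rewrite xn size_rcons in szw; case: szw => <-.
by apply: word_length_le; split=> // y yw; apply: sw; rewrite mem_rcons inE yw orbT.
Qed.

Lemma dist_adj x y : cayley_adj S x y -> (dist x y <= 1)%N.
Proof.
move=> xy; apply: (word_length_le (w := [:: x^-1 * y])); split.
  by move=> z; rewrite inE => /eqP ->.
by rewrite big_cons big_nil mulg1.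
Qed.

Lemma adj_dist x y : dist x y = 1%N -> cayley_adj S x y.
Proof.
have [[w [sw xyE] szw] _] := word_lengthP (x^-1 * y).
rewrite /dist -szw; case: w => [|l [|? ?]] // in sw xyE szw *.
by rewrite /cayley_adj -xyE big_cons big_nil mulg1 => _; apply: sw; rewrite mem_head.
Qed.

Lemma gpC o x y : gp2 o x y = gp2 o y x.
Proof. by rewrite /gp2 addnC (distC x). Qed.

Lemma gp_mul g o x y : gp2 (g * o) (g * x) (g * y) = gp2 o x y.
Proof. by rewrite /gp2 !dist_mul. Qed.

Lemma gpE o x y : (gp2 o x y + dist x y = dist o x + dist o y)%N.
Proof. by rewrite /gp2 subnK // (distC o x); apply: dist_tri. Qed.

End WordMetric.

(** The products being doubled, [delta] is twice the constant of the four-point condition. *)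
Definition hyp4 (G : groupType) (S : seq G) (delta : nat) : Prop :=
  forall o x y z : G, (minn (gp2 S o x y) (gp2 S o y z) <= gp2 S o x z + delta)%N.

Import Order.TTheory GRing.Theory Num.Theory.

Lemma rat_le_nat (r : rat) : exists n : nat, (r <= n%:R)%R.
Proof.
exists (Num.bound `|r|%R); apply: le_trans (ler_norm _) _.
by apply/ltW/archi_boundP.
Qed.

Lemma gromov_productE (G : groupType) (S : seq G) o x y : generating S ->
  gromov_product S o x y = ((gp2 S o x y)%:R / 2%:R)%R.
Proof.
move=> gS; rewrite /gromov_product /word_dist; congr (_ / _)%R.
have /(congr1 (fun n => n%:R : rat)%R) := gpE gS o x y.
by rewrite !natrD => /(canRL (addrK _)) ->.
Qed.

Lemma hyp4_gromov_hyperbolic (G : groupType) (S : seq G) : generating S ->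
  gromov_hyperbolic S -> exists delta, hyp4 S delta.
Proof.
move=> gS [delta hyp].
have two0 : (0 < 2%:R :> rat)%R by [].
have [n ndelta] := rat_le_nat (2%:R * delta)%R; exists n => o x y z; have := hyp o x y z.
by rewrite !gromov_productE // minEle lerBlDr; case: ifP => _;
  rewrite ler_pdivrMr // mulrDl divfK ?gt_eqF // [(delta * _)%R]mulrC => le1;
  have le2 := le_trans le1 (lerD (lexx _) ndelta);
  move: le2; rewrite -natrD ler_nat => le2; apply: leq_trans le2;
  [exact: geq_minl|exact: geq_minr].
Qed.

(** * Hyperbolicity and change of generators *)

Section Geodesics.
Variables (G : groupType) (S : seq G).
Hypothesis gS : generating S.
Local Notation d := (dist S).
Local Notation gp := (gp2 S).

Lemma gp_le_dist o x y : (gp o x y <= 2 * d o x)%N.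
Proof. by have := gpE gS o x y; have := dist_tri gS o x y; lia. Qed.

Lemma gp_swap o x y : (gp o x y + gp x o y = 2 * d o x)%N.
Proof.
by have := gpE gS o x y; have := gpE gS x o y; rewrite (distC gS x o); lia.
Qed.

Lemma gp_base o o' x y : (gp o x y <= gp o' x y + 2 * d o o')%N.
Proof.
have := gpE gS o x y; have := gpE gS o' x y.
by have := dist_tri gS o o' x; have := dist_tri gS o o' y; lia.
Qed.

Lemma gp_move o x x' y : (gp o x y <= gp o x' y + 2 * d x x')%N.
Proof.
have := gpE gS o x y; have := gpE gS o x' y; have := distC gS x x'.
by have := dist_tri gS o x' x; have := dist_tri gS x' x y; lia.
Qed.

Lemma gpxx o x : gp o x x = (2 * d o x)%N.
Proof. by rewrite /gp2 distxx // subn0 mul2n addnn. Qed.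

Lemma gp_betweenP w x y : (gp w x y == 0%N) = (d x y == d x w + d w y)%N.
Proof. by have := gpE gS w x y; rewrite (distC gS w x) => ?; apply/eqP/eqP; lia. Qed.

Definition geodesic (n : nat) (c : nat -> G) : Prop :=
  forall s t, (s <= t <= n)%N -> d (c s) (c t) = (t - s)%N.

Lemma dist_steps (c : nat -> G) lam s k :
  (forall t, (s <= t < s + k)%N -> (d (c t) (c t.+1) <= lam)%N) ->
  (d (c s) (c (s + k)) <= k * lam)%N.
Proof.
elim: k => [|k IHk] step; first by rewrite addn0 distxx.
have {}IHk := IHk (fun t H => step t ltac:(lia)).
have := step (s + k)%N ltac:(lia); rewrite -addnS => st.
by have := dist_tri gS (c s) (c (s + k)%N) (c (s + k.+1)%N); lia.
Qed.

Lemma steps_geodesic n (c : nat -> G) : d (c 0%N) (c n) = n ->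
  (forall t, (t < n)%N -> (d (c t) (c t.+1) <= 1)%N) -> geodesic n c.
Proof.
move=> dn step s t st.
have h1 := @dist_steps c 1 0%N s (fun u H => step u ltac:(lia)).
have h2 := @dist_steps c 1 s (t - s)%N (fun u H => step u ltac:(lia)).
have h3 := @dist_steps c 1 t (n - t)%N (fun u H => step u ltac:(lia)).
rewrite add0n in h1; rewrite !subnKC in h2 h3; try lia.
have := dist_tri gS (c 0%N) (c s) (c n); have := dist_tri gS (c s) (c t) (c n); lia.
Qed.

Lemma exists_geodesic x y :
  exists c, [/\ c 0%N = x, c (d x y) = y & geodesic (d x y) c].
Proof.
move dn: (d x y) => n; elim: n x dn => [|n IHn] x dn.
  exists (fun=> x); split=> //; first exact: (dist_eq0 gS dn).
  by move=> s t st; rewrite distxx //; lia.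
have [|z [xz zy]] := @dist_split _ _ gS x y 1; first by rewrite dn.
have [|c [c0 cn geoc]] := IHn z; first by rewrite zy dn subn1.
pose c' t := if t is t'.+1 then c t' else x.
exists c'; split=> //; apply: steps_geodesic; first by rewrite /= cn.
by move=> [|t] tn /=; [rewrite c0 xz | rewrite geoc; lia].
Qed.

End Geodesics.

Section Hyperbolic.
Variables (G : groupType) (S : seq G).
Hypothesis gS : generating S.
Variable delta : nat.
Hypothesis hyp : hyp4 S delta.
Local Notation d := (dist S).
Local Notation gp := (gp2 S).

Lemma gp_trans n o x y z :
  (n <= gp o x y)%N -> (n <= gp o y z)%N -> (n <= gp o x z + delta)%N.
Proof. by move=> h1 h2; have := hyp o x y z; lia. Qed.

(** [w] is the internal point of the triangle on the side from [x] to [y]. Rounding its position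
    down to an integer costs the [+ 1]. *)
Lemma project_geodesic x y z : exists w, [/\ d x y = (d x w + d w y)%N,
  (2 * d x w <= gp x z y <= 2 * d x w + 1)%N &
  (2 * d z w <= gp z x y + 2 * delta + 1)%N].
Proof.
have le := gp_le_dist gS x y z; rewrite (gpC gS) in le.
have [|w [xw wy]] := @dist_split _ _ gS x y (gp x z y)./2; first by lia.
exists w; rewrite wy xw; split; [lia|lia|].
have h1 : gp x w y = (2 * d x w)%N by have := gpE gS x w y; lia.
have h2 := @gp_trans (2 * d x w) x z y w ltac:(lia) ltac:(rewrite (gpC gS) h1; lia).
have := gpE gS x z w; have := gp_swap gS z x y; rewrite (distC gS z x); lia.
Qed.

Lemma exists_center x y z : exists c,
  [/\ (gp c x y <= 2 * delta + 2)%N, (gp c x z <= 2 * delta + 2)%N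
    & (gp c y z <= 2 * delta + 2)%N].
Proof.
have [w [xwy xw zw]] := project_geodesic x y z; exists w.
have := gpE gS w x y; have := gpE gS w x z; have := gpE gS w y z.
have := gpE gS z x y; have := gpE gS x z y.
have := distC gS w x; have := distC gS w z; have := distC gS w y.
have := distC gS z x; have := distC gS z y.
by case/andP: xw => xw1 xw2 *; split; lia.
Qed.

(** Bisection: each halving of the chain costs one [delta]. The loss is thus only logarithmic in the
    length, which makes long detours exponentially expensive. *)
Lemma gp_path (p : nat -> G) z n k a b : (a < b)%N -> (b - a <= 2 ^ k)%N ->
  (forall i, (a <= i < b)%N -> (n <= gp z (p i) (p i.+1))%N) ->
  (n <= gp z (p a) (p b) + k * delta)%N.
Proof.
elim: k a b => [|k IHk] a b ab ba pn.
  have -> : b = a.+1 by lia.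
  by rewrite mul0n addn0 pn; lia.
have [le|gt] := leqP (b - a) (2 ^ k).
  by have := IHk a b ab le pn; lia.
pose m := (a + 2 ^ k)%N; rewrite expnS in ba.
have p2 : (0 < 2 ^ k)%N by rewrite expn_gt0.
have h1 := IHk a m ltac:(lia) ltac:(lia) (fun i H => pn i ltac:(lia)).
have h2 := IHk m b ltac:(lia) ltac:(lia) (fun i H => pn i ltac:(lia)).
have := hyp z (p a) (p m) (p b); lia.
Qed.

End Hyperbolic.

Lemma linear_lt_expn A B : exists k0, forall k, (k0 <= k -> A + B * k < 2 ^ k)%N.
Proof.
pose m := (A + 2 * B + 1)%N; exists (2 * m)%N => k.
elim: k => [|k IHk]; first by rewrite /m; lia.
rewrite leq_eqVlt => /orP[/eqP <-|ltk].
  rewrite (mulnC 2 m) expnM -mulnn.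
  have lt := ltn_expl m (leqnn 2); apply: leq_trans (leq_mul lt lt).
  by rewrite /m; nia.
have lt := IHk ltk; rewrite expnS mulnS.
suff: (B <= B * k)%N by lia.
by rewrite leq_pmulr //; lia.
Qed.

Lemma word_length_lipschitz (G : groupType) (S S' : seq G) :
  generating S -> generating S' ->
  exists lam, forall x y, (dist S' x y <= lam * dist S x y)%N.
Proof.
move=> gS gS'; exists (\max_(l <- letters S) word_length S' l)%N => x y; rewrite /dist.
have [[w [sw <-] <-] _] := word_lengthP gS (x^-1 * y).
elim: w sw => [|l w IHw] sw; first by rewrite big_nil word_length1.
rewrite big_cons; apply: leq_trans (word_lengthM gS' _ _) _.
rewrite /= mulnS leq_add ?IHw // => [|u uw]; last by rewrite sw // inE uw orbT.
by apply: leq_bigmax_seq => //; apply: sw; rewrite mem_head.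
Qed.

Section QuasiIsometry.
Variables (G : groupType) (S S' : seq G).
Hypotheses (gS : generating S) (gS' : generating S').
Variables (delta : nat) (hyp : hyp4 S delta).
Local Notation d := (dist S).
Local Notation d' := (dist S').

(* The Morse lemma, in the direction needed here: [S]-geodesics stay close to
   [S']-geodesics. A point at maximal distance [D] from the [S']-geodesic is
   joined to itself by a detour of length O(D), which must then be at least
   exponential in [D]. *)
Lemma geodesic_near : exists D, forall n c, geodesic S' n c ->
  forall z, d (c 0%N) (c n) = (d (c 0%N) z + d z (c n))%N ->
  exists2 i, (i <= n)%N & (d z (c i) <= D)%N.
Proof.
have [lam lamP] := word_length_lipschitz gS gS'.
have [lam' lam'P] := word_length_lipschitz gS' gS.
have [k0 k0P] := linear_lt_expn (6 * lam * (lam' + 3 * delta) + 1)%N (6 * lam * delta)%N.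
exists (lam' + (k0 + 3) * delta)%N => n c geoc z0 z0n.
pose P D := `[< exists2 z, d (c 0%N) (c n) = (d (c 0%N) z + d z (c n))%N &
   forall i, (i <= n)%N -> (D <= d z (c i))%N >].
apply: contrapT => far.
have P0 : P (lam' + (k0 + 3) * delta).+1.
  apply/asboolP; exists z0 => // i ilen; rewrite ltnNge; apply/negP => le.
  by apply: far; exists i.
have ubP D : P D -> (D <= d (c 0%N) (c n))%N.
  by move=> /asboolP[z zn /(_ 0%N isT)]; rewrite (distC gS z); lia.
have [D /asboolP[z zn zfar] maxD] := ex_maxnP (ex_intro P _ P0) ubP.
have Dbig := maxD _ P0.
have near w : d (c 0%N) (c n) = (d (c 0%N) w + d w (c n))%N ->
    exists2 i, (i <= n)%N & (d w (c i) <= D)%N.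
  move=> wn; apply: contrapT => wfar; suff /maxD: P D.+1 by rewrite ltnn.
  apply/asboolP; exists w => // i ilen; rewrite ltnNge; apply/negP => le.
  by apply: wfar; exists i.
(* The detour goes from [z] along the [S]-geodesic by [2 * D], or to its end, then crosses to [c] by
   at most [D]. Since [z] is at distance at least [D] from [c], the crossing keeps a product of at
   least [2 * D] at [z]. *)
have side e : (e = c 0%N \/ e = c n) -> exists w i, [/\ (i <= n)%N,
    d z e = (d z w + d w e)%N, (d z w <= 2 * D)%N, (d w (c i) <= D)%N &
    (2 * D <= gp2 S z w (c i))%N].
  move=> ee; have [le|gt] := leqP (d z e) (2 * D).
    have [i ilen ei] : exists2 i, (i <= n)%N & e = c i.
      by case: ee => ->; [exists 0%N|exists n].
    exists e, i; rewrite -ei !distxx // addn0 gpxx //; split=> //.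
    by rewrite leq_mul2l ei zfar.
  have [w [zw we]] := dist_split gS (ltnW gt).
  have [|i ilen wi] := near w.
    have := dist_tri gS (c 0%N) w (c n); have := dist_tri gS (c 0%N) z w.
    have := dist_tri gS w z (c n); have := distC gS z w; have := distC gS z (c 0%N).
    have := distC gS w (c 0%N).
    by case: ee => ee; rewrite -?ee in zn *; lia.
  exists w, i; split=> //; try lia.
  by have := gpE gS z w (c i); have := zfar i ilen; lia.
have [w1 [i1 [i1n zw1 zw1D w1i1 g1]]] := side (c 0%N) (or_introl erefl).
have [w2 [i2 [i2n zw2 zw2D w2i2 g2]]] := side (c n) (or_intror erefl).
have gp0 : gp2 S z w1 w2 = 0%N.
  have := gpE gS z w1 w2; have := dist_tri gS (c 0%N) w1 (c n).
  have := dist_tri gS w1 w2 (c n); have := distC gS z (c 0%N); have := distC gS w1 (c 0%N).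
  by lia.
have span : (d (c i1) (c i2) <= 6 * D)%N.
  have := dist_tri gS (c i1) w1 (c i2); have := dist_tri gS w1 w2 (c i2).
  have := dist_tri gS w1 z w2; have := distC gS w1 (c i1); have := distC gS w1 z; lia.
(* The chain [w1], [c i1], ..., [c i2], [w2] has large products at [z] step by step, yet its ends
   have product 0 there, as [z] lies between them. Hence the total loss must be at least
   [2 * D - lam']. *)
have mid k : (6 * lam * D <= 2 ^ k)%N -> (2 * D <= lam' + (k + 2) * delta)%N.
  move=> kP.
  have step i : (i < n)%N -> (2 * D - lam' <= gp2 S z (c i) (c i.+1))%N.
    move=> ilt; have := gpE gS z (c i) (c i.+1).
    have := zfar i ltac:(lia); have := zfar i.+1 ilt.
    by have := lam'P (c i) (c i.+1); rewrite geoc; lia.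
  have conn a b : (a <= n)%N -> (b <= n)%N -> (a <= b)%N -> (d (c a) (c b) <= 6 * D)%N ->
      (2 * D - lam' <= gp2 S z (c a) (c b) + k * delta)%N.
    move=> an bn; rewrite leq_eqVlt => /orP[/eqP <- _|ab dab].
      by rewrite gpxx //; have := zfar a an; lia.
    apply: gp_path => //; last by move=> i ib; apply: step; lia.
    have := lamP (c a) (c b); rewrite geoc ?(ltnW ab) //; nia.
  have h12 : (2 * D - lam' <= gp2 S z (c i1) (c i2) + k * delta)%N.
    have [le|/ltnW le] := leqP i1 i2; first exact: conn.
    by rewrite (gpC gS); apply: conn => //; rewrite (distC gS).
  have := hyp z w1 (c i1) w2; have := hyp z (c i1) (c i2) w2.
  by rewrite (gpC gS z (c i2)); lia.
(* For the least admissible [k], the number [2 ^ k.-1] is below a linear function of [k]. This is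
   impossible beyond [k0], and up to [k0] the bound of [mid] contradicts the size of [D]. *)
pose k := up_log 2 (6 * lam * D).
have kD := mid k (up_logP _ (isT : (1 < 2)%N)).
have [k1|k1] := leqP (6 * lam * D)%N 1.
  by have := mid 0%N k1; lia.
have lt := up_log_gtn (isT : (1 < 2)%N) k1; rewrite -/k in lt.
have [lek|gtk] := leqP k0 k.-1.
  have big := k0P _ lek; have kE : k = k.-1.+1 by rewrite prednK // up_log_gt0 k1.
  rewrite kE in kD; have : (6 * lam * D <= 6 * lam * (lam' + (k.-1.+1 + 2) * delta))%N.
    by rewrite leq_mul2l; apply/orP; right; lia.
  by nia.
have : (k * delta <= k0 * delta)%N by rewrite leq_mul2r; apply/orP; right; lia.
lia.
Qed.

(** A small product puts [w] near an [S]-geodesic from [x] to [y], hence near an [S']-geodesic, on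
    whose points the [S']-product vanishes. *)
Lemma gp_coarse K : exists K', forall w x y, (gp2 S w x y <= K -> gp2 S' w x y <= K')%N.
Proof.
have [D near] := geodesic_near; have [lam lamP] := word_length_lipschitz gS gS'.
exists (2 * (lam * (K + 2 * delta + 1 + D)))%N => w x y wK.
have [w1 [xw1y _ ww1]] := project_geodesic gS hyp x y w.
have [c [c0 cn geoc]] := exists_geodesic gS' x y.
have [|i ilen w1i] := near _ _ geoc w1; first by rewrite c0 cn.
have ci : gp2 S' (c i) x y = 0%N.
  have g1 := geoc 0%N i ltac:(lia); have g2 := geoc i (d' x y) ltac:(lia).
  by rewrite c0 in g1; rewrite cn in g2; apply/eqP; rewrite gp_betweenP // g1 g2; lia.
have := gp_base gS' w (c i) x y; have := lamP w (c i).
have := dist_tri gS w w1 (c i); rewrite ci add0n; nia.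
Qed.

(** At an approximate center [c] of [o], [x], [z], hyperbolicity only says that one of two products
    is small, and small products survive the change of metric. The distance from [o] to [c] then
    compares the products at [o]. *)
Lemma hyp4_change : exists delta', hyp4 S' delta'.
Proof.
have [C CP] := gp_coarse (2 * delta + 2); have [C2 C2P] := gp_coarse (3 * delta + 2).
exists (C2 + 2 * C)%N => o x y z.
have [c [/CP ox /CP oz xz]] := exists_center gS hyp o x z.
have lower : (2 * d' o c <= gp2 S' o x z + 2 * C)%N.
  have := gpE gS' o x z; have := gpE gS' c o x; have := gpE gS' c o z.
  have := dist_tri gS' x c z; have := distC gS' c x; have := distC gS' c o; lia.
have : (gp2 S c x y <= 3 * delta + 2)%N \/ (gp2 S c y z <= 3 * delta + 2)%N.
  by have := hyp c x y z; lia.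
by case=> /C2P small; [have := gp_base gS' o c x y|have := gp_base gS' o c y z]; lia.
Qed.

End QuasiIsometry.

(** * Ends *)

(* A nonprincipal ultrafilter, which spares the extraction of subsequences. *)
Record ultra (W : (nat -> Prop) -> Prop) : Prop := Ultra {
  ultra_and : forall P Q, W P -> W Q -> W (fun j => P j /\ Q j);
  ultra_sub : forall P Q : nat -> Prop, (forall j, P j -> Q j) -> W P -> W Q;
  ultra_ex : forall P, W P -> exists j, P j;
  ultra_em : forall P : nat -> Prop, W P \/ W (fun j => ~ P j);
  ultra_ge : forall n, W (fun j => (n <= j)%N) }.

Lemma exists_ultra : exists W, ultra W.
Proof.
have [W [uW ooW]] := ultraFilterLemma (F := \oo%classic) _.
exists W; split.
- by move=> P Q WP WQ; apply: filterI.
- by move=> P Q PQ; apply: filterS.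
- by move=> P WP; have [j] := filter_ex WP; exists j.
- by move=> P; apply: in_ultra_setVsetC.
- by move=> n; apply: ooW; exists n.
Qed.

Section Linked.
Variables (G : groupType) (S : seq G).
Hypothesis gS : generating S.
Local Notation d := (dist S).

(** Edge paths inside an arbitrary region, possibly the complement of an infinite set; steps of
    length 0 are allowed. *)
Inductive linked (P : G -> Prop) (x : G) : G -> Prop :=
| linked0 : P x -> linked P x x
| linkedS y z : linked P x y -> (d y z <= 1)%N -> P z -> linked P x z.

Lemma linked_trans P x y z : linked P x y -> linked P y z -> linked P x z.
Proof. by move=> xy; elim=> // u v _ xu uv Pv; apply: linkedS uv Pv. Qed.

Lemma linked_sym P x y : linked P x y -> linked P y x.
Proof.
elim=> [Px|u v xu ux uv Pv]; first exact: linked0.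
apply: linked_trans ux; apply: linkedS (linked0 Pv) _ _; first by rewrite (distC gS).
by case: xu.
Qed.

Lemma linked_end P x y : linked P x y -> P x /\ P y.
Proof. by elim=> // u v _ [Px _] _ Pv. Qed.

Lemma linked_sub (P Q : G -> Prop) x y :
  (forall z, P z -> Q z) -> linked P x y -> linked Q x y.
Proof.
move=> PQ; elim=> [/PQ Qx|u v _ xu uv /PQ Qv]; first exact: linked0.
exact: linkedS uv Qv.
Qed.

Lemma linked_geodesic (P : G -> Prop) x y :
  (forall z, d x y = (d x z + d z y)%N -> P z) -> linked P x y.
Proof.
have [c [c0 cn geoc]] := exists_geodesic gS x y => Pc.
have Pct t : (t <= d x y)%N -> P (c t).
  move=> tn; apply: Pc; have := geoc 0%N t ltac:(lia); have := geoc t (d x y) ltac:(lia).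
  by rewrite c0 cn; lia.
suff all t : (t <= d x y)%N -> linked P x (c t) by rewrite -cn; apply: all.
elim: t => [_|t IHt lt]; first by rewrite c0; apply: linked0; rewrite -c0; apply: Pct.
apply: linkedS (IHt (ltnW lt)) _ (Pct _ lt).
by rewrite geoc; lia.
Qed.

Lemma linked_ivt (P : G -> Prop) (f : G -> nat) h x y :
  (forall u v, (d u v <= 1)%N -> (f v <= f u + 2)%N) ->
  (f x <= h <= f y)%N -> linked P x y -> exists2 z, P z & (h <= f z <= h + 2)%N.
Proof.
move=> flip /andP[fx fy] xy; elim: xy fy => [Px fx'|u v xu IH uv Pv fv].
  by exists x => //; lia.
have [/IH //|lt] := leqP h (f u).
by exists v => //; have := flip u v uv; lia.
Qed.

Lemma component_offP (K : seq G) x y :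
  component_off S K x y <-> linked (fun z => z \notin K) x y.
Proof.
split.
  move=> [p [xp /= /andP[xK pK] <-]].
  suff gen w q : path (cayley_adj S) w q -> all (fun v => v \notin K) q ->
      linked (fun z => z \notin K) x w -> linked (fun z => z \notin K) x (last w q).
    exact: gen (linked0 xK).
  elim: q w => [|z q IHq] w //= /andP[wz zq] /andP[zK qK] xw.
  by apply: IHq zq qK _; apply: linkedS xw (dist_adj gS wz) zK.
elim=> [xK|u v _ [p [xp pK <-]] uv vK]; first by exists [::]; rewrite /= xK.
(* A step of length 0 need not be an edge of the Cayley graph and is dropped. *)
have [uv0|uv1] := eqVneq (d (last x p) v) 0%N.
  by exists p; split=> //; apply: dist_eq0 uv0.
exists (rcons p v); rewrite rcons_path xp last_rcons -rcons_cons all_rcons vK; split=> //=.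
by apply: (adj_dist gS); lia.
Qed.

Definition proper_seq (x : nat -> G) : Prop :=
  forall m, exists N, forall n, (N <= n)%N -> (m <= d 1 (x n))%N.

Lemma seq_bound (K : seq G) : exists m, forall x, x \in K -> (d 1 x <= m)%N.
Proof.
exists (\max_(x <- K) d 1 x)%N => x xK.
exact: leq_bigmax_seq.
Qed.

Lemma finite_set_ball (A : set G) m : (forall x, A x -> (d 1 x <= m)%N) -> finite_set A.
Proof.
move=> Am; have [s sP] := ball_finite gS m.
apply: (sub_finite_set (B := [set` s]%classic)); last exact: finite_seq.
by move=> x /Am; rewrite /dist invg1 mul1g => /sP.
Qed.

Lemma tail_linked (K : seq G) (x : nat -> G) l : proper_seq x ->
  (forall n, (d (x n) (x n.+1) <= l)%N) ->
  exists N, forall n m, (N <= n)%N -> (N <= m)%N ->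
    linked (fun z => z \notin K) (x n) (x m).
Proof.
move=> px step; have [m Km] := seq_bound K; have [N far] := px (m + l).+1.
have up n k : (N <= n)%N -> linked (fun z => z \notin K) (x n) (x (n + k)%N).
  move=> Nn; elim: k => [|k IHk].
    by rewrite addn0; apply: linked0; apply/negP => /Km; have := far n Nn; lia.
  apply: linked_trans IHk _; rewrite addnS; apply: linked_geodesic => z xzx.
  apply/negP => /Km; have := far (n + k)%N ltac:(lia).
  have := step (n + k)%N; have := dist_tri gS 1 z (x (n + k)%N).
  by have := distC gS z (x (n + k)%N); lia.
exists N => n k Nn Nk; have [le|/ltnW le] := leqP n k; last apply: linked_sym.
  by rewrite -(subnKC le); apply: up.
by rewrite -(subnKC le); apply: up.
Qed.

Lemma one_ended_linked (K : seq G) (x y : nat -> G) l : one_ended S ->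
  proper_seq x -> proper_seq y ->
  (forall n, (d (x n) (x n.+1) <= l)%N) -> (forall n, (d (y n) (y n.+1) <= l)%N) ->
  exists N, forall n m, (N <= n)%N -> (N <= m)%N ->
    linked (fun z => z \notin K) (x n) (y m).
Proof.
move=> oe px py sx sy.
have ub z : proper_seq z -> (forall n, (d (z n) (z n.+1) <= l)%N) -> exists N, forall n,
    (N <= n)%N -> z n \notin K /\ unbounded_component S K (component_off S K (z n)).
  move=> pz sz; have [N lz] := tail_linked K pz sz; exists N => n Nn.
  have [znK _] := linked_end (lz _ _ Nn Nn); split=> //; split; first by exists (z n).
  move=> /finite_seqP[s sE]; have [m sm] := seq_bound s.
  have [N' far] := pz m.+1; pose k := maxn N N'.
  have : component_off S K (z n) (z k) by apply/component_offP/lz => //; lia.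
  by rewrite sE /= => /sm; have := far k ltac:(lia); lia.
have [N1 ux] := ub x px sx; have [N2 uy] := ub y py sy.
have [C [_ Cu]] := oe K.
exists (maxn N1 N2) => n m nN mN; apply/component_offP.
have [_ uxn] := ux n ltac:(lia); have [ymK uym] := uy m ltac:(lia).
by rewrite -(Cu _ uxn) (Cu _ uym); apply/component_offP/linked0.
Qed.

End Linked.

Lemma ultra_choice W (T : eqType) (f : nat -> T) (s : seq T) : ultra W ->
  W (fun j => f j \in s) -> exists2 v, v \in s & W (fun j => f j = v).
Proof.
move=> uW; elim: s => [|v s IHs] fs.
  by have [j] := ultra_ex uW fs.
have [vf|nv] := ultra_em uW (fun j => f j = v); first by exists v; rewrite ?mem_head.
have [|w ws fw] := IHs; last by exists w; rewrite // inE ws orbT.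
apply: (ultra_sub uW _ (ultra_and uW fs nv)) => j [+ /eqP nfv].
by rewrite inE (negPf nfv).
Qed.

Section Limits.
Variables (G : groupType) (S : seq G).
Hypothesis gS : generating S.
Variables (W : (nat -> Prop) -> Prop) (uW : ultra W).
Local Notation d := (dist S).
Local Notation gp := (gp2 S).

Lemma ultra_ball (f : nat -> G) n : W (fun j => (d 1 (f j) <= n)%N) ->
  exists v, W (fun j => f j = v).
Proof.
have [s sP] := ball_finite gS n => Wf.
have [|v _ Wv] := @ultra_choice W G f s uW _; last by exists v.
by apply: (ultra_sub uW _ Wf) => j; rewrite /dist invg1 mul1g => /sP.
Qed.

(** The points at distance [n] from 1 on geodesics to the [q j] range over a finite ball, so the
    ultrafilter selects one. The choices for different [n] are independent: [r] is a ray only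
    coarsely. *)
Lemma ultra_ray (q : nat -> G) : (forall n, W (fun j => (n <= d 1 (q j))%N)) ->
  exists r, forall n, d 1 (r n) = n /\ W (fun j => gp 1 (r n) (q j) = (2 * n)%N).
Proof.
move=> qfar; suff /choice[r rP] : forall n, exists v, d 1 v = n /\
    W (fun j => gp 1 v (q j) = (2 * n)%N) by exists r.
move=> n.
have /choice[f fP] : forall j, exists v, (n <= d 1 (q j))%N ->
    d 1 v = n /\ d v (q j) = (d 1 (q j) - n)%N.
  move=> j; have [le|_] := leqP n (d 1 (q j)); last by exists 1.
  by have [v vP] := dist_split gS le; exists v.
have [|v Wv] := @ultra_ball f n.
  by apply: (ultra_sub uW _ (qfar n)) => j /fP[-> _].
exists v; have Wall := ultra_and uW (qfar n) Wv.
have [j [/fP jn jv]] := ultra_ex uW Wall; split; first by rewrite -jv; case: jn.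
apply: (ultra_sub uW _ Wall) => k [kn <-]; have [v1 vk] := fP k kn.
by have := gpE gS 1 (f k) (q k); lia.
Qed.

End Limits.

Section Directions.
Variables (G : groupType) (S : seq G).
Hypothesis gS : generating S.
Variables (delta : nat) (hyp : hyp4 S delta) (oe : one_ended S).
Local Notation d := (dist S).
Local Notation gp := (gp2 S).

Lemma one_ended_far n : exists v, d 1 v = n.
Proof.
have [C [[_ infC] _]] := oe [::]; apply: contrapT => nov; apply: infC.
apply: (finite_set_ball gS (m := n)) => x _; rewrite leqNgt; apply/negP => lt.
by apply: nov; have [z [z1 _]] := dist_split gS (ltnW lt); exists z.
Qed.

(** Geodesics of length [2 * k] are translated to have their midpoints at 1, so that limits can be
    taken in both directions. *)
Lemma biinfinite_geodesic : exists a b : nat -> G, forall m n,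
  [/\ d (a m) (b n) = (m + n)%N, d (a m) (a n) = (maxn m n - minn m n)%N
    & d (b m) (b n) = (maxn m n - minn m n)%N].
Proof.
have [W uW] := exists_ultra.
have /choice[c cP] : forall k, exists c, geodesic S (2 * k) c /\ c k = 1.
  move=> k; have [v v2k] := one_ended_far (2 * k).
  have [c [c0 cn geoc]] := exists_geodesic gS 1 v; rewrite v2k in cn geoc.
  exists (fun t => (c k)^-1 * c t); split; last by rewrite mulVg.
  by move=> s t st; rewrite dist_mul geoc.
have lim (f : nat -> nat -> nat) : (forall n k, (n <= k)%N ->
      (f n k <= 2 * k)%N /\ (maxn k (f n k) - minn k (f n k) <= n)%N) ->
    exists r, forall n, W (fun k => c k (f n k) = r n).
  move=> fP; suff /choice[r rP] : forall n, exists v, W (fun k => c k (f n k) = v) by exists r.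
  move=> n; apply: (ultra_ball gS uW (n := n)).
  apply: (ultra_sub uW _ (ultra_ge uW n)) => k nk; have [f2 fk] := fP n k nk.
  have [geoc ck] := cP k; rewrite -{1}ck.
  have [le|/ltnW le] := leqP k (f n k); last rewrite (distC gS); rewrite geoc; lia.
have [|a aP] := lim (fun n k => k - n)%N; first by move=> n k nk; lia.
have [|b bP] := lim (fun n k => k + n)%N; first by move=> n k nk; lia.
exists a, b => m n.
have Wall := ultra_and uW (ultra_and uW (aP m) (aP n)) (ultra_and uW (bP m) (bP n)).
have [k [kmn [[<- <-] [<- <-]]]] := ultra_ex uW (ultra_and uW (ultra_ge uW (m + n)) Wall).
have [geoc _] := cP k; split.
- by rewrite geoc; lia.
- by have [le|/ltnW le] := leqP m n; [rewrite (distC gS)|]; rewrite geoc; lia.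
- by have [le|/ltnW le] := leqP m n; [|rewrite (distC gS)]; rewrite geoc; lia.
Qed.

(* By one-endedness, a path far from 1 joins the two ends of a bi-infinite
   geodesic; by continuity of the Gromov product with one end, it meets
   points whose product with that end takes any prescribed value. *)
Lemma directions : exists c (xi : nat -> nat -> G),
  [/\ forall i n, d 1 (xi i n) = n,
      forall i m n, (2 * minn m n <= gp 1 (xi i m) (xi i n) + delta)%N &
      forall i j m n, (i < j < 4)%N -> (gp 1 (xi i m) (xi j n) <= c)%N].
Proof.
have [W uW] := exists_ultra.
have [a [b ab]] := biinfinite_geodesic.
have a0 : a 0%N = b 0%N by apply: (dist_eq0 gS); have [-> _ _] := ab 0%N 0%N.
pose o := b 0%N; pose ga n := o^-1 * a n; pose gb n := o^-1 * b n.
have da n : d 1 (ga n) = n.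
  by rewrite -(dist_mul _ o) mulg1 mulVKg /o -a0; have [_ -> _] := ab 0%N n; lia.
have db n : d 1 (gb n) = n.
  by rewrite -(dist_mul _ o) mulg1 mulVKg; have [_ _ ->] := ab 0%N n; lia.
have dab m n : d (ga m) (gb n) = (m + n)%N by rewrite dist_mul; have [] := ab m n.
have dbb m n : d (gb m) (gb n) = (maxn m n - minn m n)%N.
  by rewrite dist_mul; have [] := ab m n.
have daa m n : d (ga m) (ga n) = (maxn m n - minn m n)%N.
  by rewrite dist_mul; have [] := ab m n.
(* Along a path outside the ball of radius [rho] from [ga k] to [gb k], the product with [gb k] goes
   from 0 to [2 * k] and rises by at most 2 per edge. *)
have level h rho : exists z k, (h <= rho)%N ->
    [/\ (rho <= d 1 z)%N, (rho <= k)%N & (h <= gp 1 z (gb k) <= h + 2)%N].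
  have [hr|_] := leqP h rho; last by exists 1, 0%N.
  have [s sP] := ball_finite gS rho.
  have pa : proper_seq S ga by move=> m; exists m => n; rewrite da.
  have pb : proper_seq S gb by move=> m; exists m => n; rewrite db.
  have [N lN] := @one_ended_linked _ _ gS s ga gb 1 oe pa pb
    (fun n => ltac:(by rewrite daa; lia)) (fun n => ltac:(by rewrite dbb; lia)).
  pose k := maxn N rho; have lk := lN k k ltac:(lia) ltac:(lia).
  have [||z zs zh] := linked_ivt (f := fun z => gp 1 z (gb k)) (h := h) _ _ lk.
  - by move=> u v uv; have := gp_move gS 1 v u (gb k); rewrite (distC gS v u); lia.
  - by rewrite /gp2 !da !db !dab (distxx gS); lia.
  - exists z, k => _; split=> //; last by lia.
    rewrite leqNgt; apply/negP => /ltnW zr; case/negP: zs.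
    by apply: sP; move: zr; rewrite /dist invg1 mul1g.
have /choice[z /choice[k zk]] : forall h, exists z : nat -> G, exists k : nat -> nat,
    forall rho, (h <= rho)%N ->
    [/\ (rho <= d 1 (z rho))%N, (rho <= k rho)%N & (h <= gp 1 (z rho) (gb (k rho)) <= h + 2)%N].
  by move=> h; have /choice[z /choice[k zk]] := level h; exists z, k.
have /choice[eta etaP] : forall h, exists r, forall n, d 1 (r n) = n /\
    W (fun j => gp 1 (r n) (z h j) = (2 * n)%N).
  move=> h; apply: (ultra_ray gS uW) => n.
  by apply: (ultra_sub uW _ (ultra_ge uW (maxn h n))) => j jn; have [|? _ _] := zk h j; lia.
have eta_gb h n m : (h + 3 + 2 * delta <= 2 * n)%N -> (h + 3 + 2 * delta <= 2 * m)%N ->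
    (h <= gp 1 (eta h n) (gb m) + 2 * delta)%N /\
    (gp 1 (eta h n) (gb m) <= h + 2 + 2 * delta)%N.
  move=> hn hm; have [_ Wn] := etaP h n.
  have [j [jhm gn]] := ultra_ex uW (ultra_and uW (ultra_ge uW (maxn h m)) Wn).
  have [|_ jk zh] := zk h j; first by lia.
  have gm : gp 1 (gb m) (gb (k h j)) = (2 * m)%N.
    by have := gpE gS 1 (gb m) (gb (k h j)); rewrite !db dbb; lia.
  have h1 := hyp 1 (eta h n) (z h j) (gb m).
  have h2 := hyp 1 (z h j) (gb (k h j)) (gb m).
  have h3 := hyp 1 (z h j) (eta h n) (gb (k h j)).
  have h4 := hyp 1 (eta h n) (gb m) (gb (k h j)).
  rewrite (gpC gS 1 (gb (k h j))) (gpC gS 1 (z h j) (eta h n)) in h1 h2 h3 h4.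
  by move: zh => /andP[zh1 zh2]; split; lia.
(* The spacing [H] exceeds the errors in the products with [gb], so two limit rays of different
   levels cannot stay together. [C] also covers the points too close to 1 for [eta_gb]. *)
pose H := (6 * delta + 6)%N; pose C := (6 * H + 10 * delta + 10)%N.
exists C, (fun i => eta (i * H)%N); split.
- by move=> i n; have [] := etaP (i * H)%N n.
- move=> i m n; have [_ Wm] := etaP (i * H)%N m; have [_ Wn] := etaP (i * H)%N n.
  have [j [gm gn]] := ultra_ex uW (ultra_and uW Wm Wn).
  have := hyp 1 (eta (i * H)%N m) (z (i * H)%N j) (eta (i * H)%N n).
  by rewrite (gpC gS 1 (z _ _)) gm gn; lia.
- move=> i j m n ij4; have [dm _] := etaP (i * H)%N m; have [dn _] := etaP (j * H)%N n.
  have im := gp_le_dist gS 1 (eta (i * H)%N m) (eta (j * H)%N n).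
  have jn := gp_le_dist gS 1 (eta (j * H)%N n) (eta (i * H)%N m).
  rewrite (gpC gS) in jn; rewrite ?dm ?dn in im jn.
  have Hij : (i * H + H <= j * H)%N by rewrite -mulSnr leq_mul2r; lia.
  have Hj : (j * H <= 3 * H)%N by rewrite leq_mul2r; lia.
  have [big|] := leqP (3 * H + 3 + 2 * delta) (2 * minn m n); last by rewrite /C; lia.
  have [_ hi] := eta_gb (i * H)%N m (maxn m n) ltac:(lia) ltac:(lia).
  have [hj _] := eta_gb (j * H)%N n (maxn m n) ltac:(lia) ltac:(lia).
  have := hyp 1 (eta (i * H)%N m) (eta (j * H)%N n) (gb (maxn m n)).
  by rewrite /C /H in Hij hi hj *; lia.
Qed.

End Directions.

(** * The boundary and its cut pairs *)

Section Boundary.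
Variables (G : groupType) (S : seq G).
Hypothesis gS : generating S.
Variables (delta : nat) (hyp : hyp4 S delta).
Local Notation d := (dist S).
Local Notation gp := (gp2 S).
Import Order.TTheory GRing.Theory Num.Theory.

Definition asymptotic (x y : nat -> G) : Prop :=
  forall h, exists N, forall n m, (N <= n)%N -> (N <= m)%N -> (h <= gp 1 (x n) (y m))%N.

Lemma gromov_product_ge o x y h :
  (h%:R <= gromov_product S o x y)%R = (2 * h <= gp o x y)%N.
Proof. by rewrite gromov_productE // ler_pdivlMr // -natrM ler_nat mulnC. Qed.

Lemma same_endpointP x y : same_endpoint S x y <-> asymptotic x y.
Proof.
split=> xy => [h|r].
  have [N NP] := xy h%:R%R; exists N => n m Nn Nm.
  by have := NP n m Nn Nm; rewrite gromov_product_ge; lia.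
have [h hr] := rat_le_nat r.
have [N NP] := xy (2 * h)%N; exists N => n m Nn Nm.
by apply: le_trans hr _; rewrite gromov_product_ge NP.
Qed.

Lemma asymptotic_sym x y : asymptotic x y -> asymptotic y x.
Proof.
by move=> xy h; have [N NP] := xy h; exists N => n m Nn Nm; rewrite (gpC gS) NP.
Qed.

Lemma asymptotic_trans y x z : asymptotic x y -> asymptotic y z -> asymptotic x z.
Proof.
move=> xy yz h; have [N NP] := xy (h + delta)%N; have [N' NP'] := yz (h + delta)%N.
exists (maxn N N') => n m Nn Nm.
have := NP n N' ltac:(lia); have := NP' N' m ltac:(lia) ltac:(lia).
have := NP n (maxn N N') ltac:(lia) ltac:(lia).
have := NP' (maxn N N') m ltac:(lia) ltac:(lia).
by have := hyp 1 (x n) (y (maxn N N')) (z m); lia.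
Qed.

(** Late products within each sequence are large, so a single large late product between [x] and [y]
    makes all of them large, up to [2 * delta]. *)
Lemma asymptotic_bound x y : asymptotic x x -> asymptotic y y -> ~ asymptotic x y ->
  exists h N, forall n m, (N <= n)%N -> (N <= m)%N -> (gp 1 (x n) (y m) <= h)%N.
Proof.
move=> xx yy; apply: contra_notP => nb h.
have [N NP] := xx (h + 2 * delta)%N; have [N' NP'] := yy (h + 2 * delta)%N.
have [k [l [kN [lN big]]]] : exists k l, (maxn N N' <= k)%N /\ (maxn N N' <= l)%N /\
    (h + 2 * delta <= gp 1 (x k) (y l))%N.
  apply: contrapT => no; apply: nb; exists (h + 2 * delta)%N, (maxn N N') => k l kN lN.
  by rewrite leqNgt; apply/negP => lt; apply: no; exists k, l; split=> //; lia.
exists (maxn N N') => n m Nn Nm.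
have := NP n k ltac:(lia) ltac:(lia); have := NP' l m ltac:(lia) ltac:(lia).
have := hyp 1 (x n) (x k) (y l); have := hyp 1 (x n) (y l) (y m); lia.
Qed.

Local Notation M := (gromov_boundary S).

Lemma boundary_point_ex x : asymptotic x x -> exists p : M, val p x.
Proof.
move=> /same_endpointP xx.
have xP : endpoint S x \in [set endpoint S x | x in converges_to_infinity S]%classic.
  by apply: mem_set; exists x.
by exists (exist _ (endpoint S x) xP); split.
Qed.

Lemma val_endpoint (p : M) : exists z, forall x,
  val p x <-> asymptotic x x /\ asymptotic z x.
Proof.
case: p => [P Pin] /=; have /set_mem[z _ <-] := Pin; exists z => x.
by split=> -[xx zx]; split; apply/same_endpointP.
Qed.

Lemma val_asymptotic (p : M) x : val p x -> asymptotic x x.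
Proof. by have [z zP] := val_endpoint p; case/zP. Qed.

Lemma val_asymptotic2 (p : M) x y : val p x -> val p y -> asymptotic x y.
Proof.
have [z zP] := val_endpoint p => /zP[_ zx] /zP[_ zy].
exact: asymptotic_trans (asymptotic_sym zx) zy.
Qed.

Lemma val_ex (p : M) : exists x, val p x.
Proof. by case: p => [P Pin] /=; have /set_mem[z zz <-] := Pin; exists z; split. Qed.

Lemma point_eq (p q : M) x y : val p x -> val q y -> asymptotic x y -> p = q.
Proof.
move=> px qy xy; apply: val_inj.
have [u uP] := val_endpoint p; have [v vP] := val_endpoint q.
have [_ ux] := (uP x).1 px; have [_ vy] := (vP y).1 qy.
have uv : asymptotic u v.
  exact: asymptotic_trans ux (asymptotic_trans xy (asymptotic_sym vy)).
rewrite eqEsubset; split=> w.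
  move=> /uP[ww uw]; apply/vP; split=> //.
  exact: asymptotic_trans (asymptotic_sym uv) uw.
by move=> /vP[ww vw]; apply/uP; split=> //; apply: asymptotic_trans uv vw.
Qed.

Lemma open_boundaryE (A : set M) : open A = boundary_open A.
Proof. by []. Qed.

(** Neighbourhoods may be tested with one fixed representative of their center, since changing it
    costs only [delta]. *)
Lemma boundary_openW (A : set M) :
  (forall p x, A p -> val p x -> exists h, forall q y, val q y ->
    (exists N, forall n m, (N <= n)%N -> (N <= m)%N -> (h <= gp 1 (x n) (y m))%N) -> A q) ->
  open A.
Proof.
rewrite open_boundaryE => openA p Ap; have [x px] := val_ex p; have [h hP] := openA p x Ap px.
exists (h + delta)%:R%R => q [x' [y [px' qy [N NP]]]].
have [N' NP'] := val_asymptotic2 px px' (h + delta)%N.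
apply: hP qy _; exists (maxn N N') => n m Nn Nm.
have := NP (maxn N N') m ltac:(lia) ltac:(lia); rewrite gromov_product_ge.
have := NP' n (maxn N N') ltac:(lia) ltac:(lia).
by have := hyp 1 (x n) (x' (maxn N N')) (y m); lia.
Qed.

Lemma cut_pair_of_partition (a b : M) (A B : set M) : a <> b -> open A -> open B ->
  (exists p, A p) -> (exists p, B p) -> (forall p, A p -> ~ B p) ->
  (forall p, A p \/ B p <-> p <> a /\ p <> b) -> cut_pair a b.
Proof.
move=> ab oA oB [p Ap] [q Bq] disj cover; split=> // con.
have AE : A = setC [set a; b]%classic.
  apply: con; first by exists p.
  - exists A => //; rewrite eqEsubset; split=> [u Au|u []//]; split=> //.
    by have [ua ub] := (cover u).1 (or_introl Au); case.
  - exists (setC B); first exact: open_closedC.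
    rewrite eqEsubset; split=> u.
      move=> Au; split; last exact: disj.
      by have [ua ub] := (cover u).1 (or_introl Au); case.
    move=> [uab nBu]; have [|//|//] := (cover u).2 _.
    by split=> ue; apply: uab; [left|right].
apply: (disj q) => //; rewrite AE; case=> qe.
  by have [] := (cover q).1 (or_intror Bq).
by have [] := (cover q).1 (or_intror Bq).
Qed.

(** Points are closed. This serves when the two limit points coincide and a second point has to be
    removed. *)
Lemma open_setD1 (A : set M) (b : M) : open A -> open (setD A [set b]%classic).
Proof.
move=> oA; apply: boundary_openW => p x [Ap pb] px.
have [y qy] := val_ex b.
have [|h [N hP]] := asymptotic_bound (val_asymptotic px) (val_asymptotic qy).
  by move=> xy; apply: pb; apply: point_eq px qy xy.
rewrite open_boundaryE in oA; have [r rA] := oA p Ap.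
have [k kr] := rat_le_nat r.
exists (2 * k + h + delta).+1 => q z qz [N' NP']; split.
  apply: rA; exists x, z; split=> //; exists N' => i j Ni Nj.
  by apply: le_trans kr _; rewrite gromov_product_ge; have := NP' i j Ni Nj; lia.
move=> qb; rewrite qb in qz; have [N2 NP2] := val_asymptotic2 qz qy (2 * k + h + delta).+1.
pose n := maxn N (maxn N' N2).
have := NP' n n ltac:(lia) ltac:(lia); have := NP2 n n ltac:(lia) ltac:(lia).
by have := hP n n ltac:(lia) ltac:(lia); have := hyp 1 (x n) (z n) (y n); lia.
Qed.

End Boundary.

(** * Pushing paths to infinity *)

Section Escape.
Variables (G : groupType) (S : seq G).
Hypothesis gS : generating S.
Variables (delta : nat) (hyp : hyp4 S delta).
Local Notation d := (dist S).
Local Notation gp := (gp2 S).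

(* Seen from [x], the set [Q] lies in the directions of at most two points. *)
Definition two_spotted (T : nat) (x : G) (Q : G -> Prop) : Prop :=
  exists q1 q2, [/\ (T <= d x q1)%N, (T <= d x q2)%N &
    forall q, Q q -> (T <= gp x q q1)%N \/ (T <= gp x q q2)%N].

Definition escapable : Prop := forall L, exists T m, forall x (Q : G -> Prop),
  two_spotted T x Q ->
  exists2 x', (d x x' <= m)%N & forall q, Q q -> (d x q + L <= d x' q)%N.

(** The finitary form of the absence of cut pairs: [M] and [T] depend on [m] alone, not on [Q] or on
    the level [N]. The path may come closer to [Q] than its ends, by [slack]. *)
Definition connectable (slack : nat) : Prop :=
  forall m, exists M T, forall x (Q : G -> Prop) N z z', two_spotted T x Q ->
  (d x z <= m)%N -> (d x z' <= m)%N ->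
  (forall q, Q q -> (N + slack <= d z q)%N) ->
  (forall q, Q q -> (N + slack <= d z' q)%N) ->
  linked S (fun w => (d x w <= M)%N /\ forall q, Q q -> (N <= d w q)%N) z z'.

Variables (c : nat) (xi : nat -> nat -> G).
Hypotheses (dxi : forall i n, d 1 (xi i n) = n)
  (gxixi : forall i j m n, (i < j < 4)%N -> (gp 1 (xi i m) (xi j n) <= c)%N).

(* Each of [q1] and [q2] obstructs at most one of the four directions. *)
Lemma free_directions x q1 q2 : exists i j, (i < j < 4)%N /\
  forall k n, k \in [:: i; j] ->
    (gp x (x * xi k n) q1 <= c + delta)%N /\ (gp x (x * xi k n) q2 <= c + delta)%N.
Proof.
pose bad q k := `[< exists n, (c + delta < gp x (x * xi k n) q)%N >].
have uniq_bad q i j : (i < j < 4)%N -> bad q i -> bad q j -> False.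
  move=> ij /asboolP[m im] /asboolP[n jn]; have := gxixi m n ij.
  have := hyp x (x * xi i m) q (x * xi j n); rewrite (gpC gS x q).
  by have := gp_mul S x 1 (xi i m) (xi j n); rewrite mulg1; lia.
have notbad q k n : ~~ bad q k -> (gp x (x * xi k n) q <= c + delta)%N.
  by move=> /asboolPn nb; rewrite leqNgt; apply/negP => lt; apply: nb; exists n.
pose ok k := ~~ bad q1 k && ~~ bad q2 k.
suff [i [j [ij oi oj]]] : exists i j, [/\ (i < j < 4)%N, ok i & ok j].
  exists i, j; split=> // k n; rewrite !inE.
  by case/orP=> /eqP ->; [move: oi|move: oj]; case/andP=> *; split; apply: notbad.
have u q i j : (i < j < 4)%N -> ~~ (bad q i && bad q j).
  by move=> ij; apply/negP => /andP[]; apply: uniq_bad ij.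
have := (u q1 0%N 1%N isT, u q1 0%N 2%N isT, u q1 0%N 3%N isT,
         u q1 1%N 2%N isT, u q1 1%N 3%N isT, u q1 2%N 3%N isT).
have := (u q2 0%N 1%N isT, u q2 0%N 2%N isT, u q2 0%N 3%N isT,
         u q2 1%N 2%N isT, u q2 1%N 3%N isT, u q2 2%N 3%N isT).
move=> [[[[[u1 u2] u3] u4] u5] u6] [[[[[v1 v2] v3] v4] v5] v6].
case o0 : (ok 0%N); case o1 : (ok 1%N); try (by exists 0%N, 1%N);
  case o2 : (ok 2%N); try (by exists 0%N, 2%N); try (by exists 1%N, 2%N);
  case o3 : (ok 3%N); try (by exists 0%N, 3%N); try (by exists 1%N, 3%N);
  try (by exists 2%N, 3%N); exfalso; move: o0 o1 o2 o3; rewrite /ok; lia.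
Qed.

Lemma spot_gp T x w q q1 : (c + 2 * delta < T)%N -> (gp x w q1 <= c + delta)%N ->
  (T <= gp x q q1)%N -> (gp x w q <= c + 2 * delta)%N.
Proof. by move=> cT wq qq; have := hyp x w q q1; lia. Qed.

(** A free direction has product at most [c + 2 * delta] with all of [Q], so all but this much of
    the displacement is gained in distance. *)
Lemma escape : escapable.
Proof.
move=> L; exists (c + 2 * delta).+1, (c + 2 * delta + L)%N => x Q [q1 [q2 [_ _ spot]]].
have [i [_ [_ /(_ i _ (mem_head _ _)) free]]] := free_directions x q1 q2.
exists (x * xi i (c + 2 * delta + L)); first by rewrite dist_mulr dxi.
move=> q /spot Qq; have := gpE gS x (x * xi i (c + 2 * delta + L)) q.
rewrite dist_mulr dxi; have [h1 h2] := free (c + 2 * delta + L)%N.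
by case: Qq => /(spot_gp (leqnn _)) qq; [have := qq _ h1|have := qq _ h2]; lia.
Qed.

End Escape.

(** * Cut pairs from limits of obstacles *)

Section LimitCutPair.
Variables (G : groupType) (S : seq G).
Hypothesis gS : generating S.
Variables (delta : nat) (hyp : hyp4 S delta).
Local Notation d := (dist S).
Local Notation gp := (gp2 S).
Local Notation M := (gromov_boundary S).
Variables (c : nat) (xi : nat -> nat -> G).
Hypotheses (dxi : forall i n, d 1 (xi i n) = n)
  (gxi : forall i m n, (2 * minn m n <= gp 1 (xi i m) (xi i n) + delta)%N)
  (gxixi : forall i j m n, (i < j < 4)%N -> (gp 1 (xi i m) (xi j n) <= c)%N).

Variables (W : (nat -> Prop) -> Prop) (uW : ultra W).
Variables (Q : nat -> G -> Prop) (N : nat -> nat) (q1 q2 : nat -> G).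
Hypothesis (spot : forall j q, Q j q -> (j <= gp 1 q (q1 j))%N \/ (j <= gp 1 q (q2 j))%N).

(** [U] is the limit of the regions at distance at least [N j] from [Q j]. These sets recede in the
    directions of [r1] and [r2] while [N j] is unrestricted, so [U] is akin to the complement of
    horoballs at the ends of these rays. *)
Let U w := W (fun j => forall q, Q j q -> (N j <= d w q)%N).
Let out z := W (fun j => forall q, Q j q -> (N j + (c + 3 * delta + 1) <= d z q)%N).

Variables r1 r2 : nat -> G.
Hypotheses (r1P : forall n, d 1 (r1 n) = n /\ W (fun j => gp 1 (r1 n) (q1 j) = (2 * n)%N))
           (r2P : forall n, d 1 (r2 n) = n /\ W (fun j => gp 1 (r2 n) (q2 j) = (2 * n)%N)).

Lemma ray_asymptotic (q r : nat -> G) :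
  (forall n, d 1 (r n) = n /\ W (fun j => gp 1 (r n) (q j) = (2 * n)%N)) ->
  asymptotic S r r.
Proof.
move=> rP h; exists (h + delta)%N => m n hm hn.
have [_ Wm] := rP m; have [_ Wn] := rP n; have [j [jm jn]] := ultra_ex uW (ultra_and uW Wm Wn).
by have := hyp 1 (r m) (q j) (r n); rewrite (gpC gS 1 (q j)) jm jn; lia.
Qed.

Let near rho w (x : nat -> G) := exists n0, forall n, (n0 <= n)%N -> (rho <= gp 1 w (x n))%N.

Let avoids (x : nat -> G) := exists h n0, forall n k, (n0 <= n)%N -> (n0 <= k)%N ->
  (gp 1 (x n) (r1 k) <= h)%N /\ (gp 1 (x n) (r2 k) <= h)%N.

(** A point [w] in the direction of [x] has bounded product with the points of [Q j], so its
    distance to them exceeds theirs to 1 by [d 1 w] up to a constant; [z0] ensures that the latter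
    is nearly [N j]. *)
Lemma near_unobstructed z0 x : out z0 -> avoids x ->
  exists rho, forall w, near rho w x -> U w.
Proof.
move=> oz0 [h [n0 hP]]; have [h' h'E] : exists h', h' = (h + 3 * delta)%N by exists (h + 3 * delta)%N.
exists (2 * (d 1 z0 + h' + 1))%N => w [n1 wx].
pose n := maxn n0 n1; pose k := maxn n0 h'.+1.
have [_ W1] := r1P k; have [_ W2] := r2P k.
have Wall := ultra_and uW (ultra_and uW oz0 (ultra_ge uW h'.+1)) (ultra_and uW W1 W2).
apply: (ultra_sub uW _ Wall) => j [[zj jh] [k1 k2]] q Qq.
have small : (gp 1 w q <= h')%N.
  rewrite leqNgt; apply/negP => big; have := wx n ltac:(lia).
  have [hn1 hn2] := hP n k ltac:(lia) ltac:(lia).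
  have := hyp 1 (x n) w q; rewrite (gpC gS 1 (x n) w).
  case: (spot Qq) => [jq|jq].
    have := hyp 1 (x n) q (q1 j); have := hyp 1 (x n) (q1 j) (r1 k).
    by rewrite (gpC gS 1 (q1 j) (r1 k)) k1; lia.
  have := hyp 1 (x n) q (q2 j); have := hyp 1 (x n) (q2 j) (r2 k).
  by rewrite (gpC gS 1 (q2 j) (r2 k)) k2; lia.
have := zj q Qq; have := gpE gS 1 w q; have := gp_le_dist gS 1 w (x n1).
by have := wx n1 (leqnn _); have := dist_tri gS z0 1 q; rewrite (distC gS z0 1); lia.
Qed.

(** Shadows of boundary points are quasiconvex, so deep enough they lie in a single component of
    [U]. *)
Lemma near_linked rho x : (forall w, near rho w x -> U w) ->
  forall w w', near (rho + 2 * delta) w x -> near (rho + 2 * delta) w' x ->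
  linked S U w w'.
Proof.
move=> nU w w' [n0 wx] [n1 wx']; apply: (linked_geodesic gS) => v wvw'.
apply: nU; exists (maxn n0 n1) => n nn.
have := wx n ltac:(lia); have := wx' n ltac:(lia).
have := gpE gS 1 v w; have := gpE gS 1 v w'; have := gpE gS 1 w w'.
have := dist_tri gS 1 v w; have := dist_tri gS 1 v w'; have := distC gS v w.
have := hyp 1 w (x n) w'; rewrite (gpC gS 1 (x n) w').
have := hyp 1 v w (x n); have := hyp 1 v w' (x n); lia.
Qed.

Lemma near_seq rho x : asymptotic S x x -> exists n0, forall n, (n0 <= n)%N -> near rho (x n) x.
Proof. by move=> /(_ rho)[n0 xx]; exists n0 => n nn; exists n0 => k; apply: xx. Qed.

Variable z0 : G.
Hypothesis oz0 : out z0.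

Let side (K : G -> Prop) : set M := [set p | exists x, [/\ val p x, avoids x &
  exists rho, forall w, near rho w x -> K w]]%classic.

Lemma open_side K : open (side K).
Proof.
apply: (boundary_openW gS hyp) => p x [x' [px' [h [n0 hP]] [rho rhoP]]] px.
exists (h + rho + 3 * delta + 1)%N => q y qy [n1 xy].
have [n2 xx] := val_asymptotic2 gS hyp px px' (h + rho + 3 * delta + 1)%N.
have xy' n m : (maxn n1 n2 <= n)%N -> (maxn n1 n2 <= m)%N -> (h + rho + 2 * delta + 1 <= gp 1 (x' n) (y m))%N.
  move=> nn mm; have := xx n n ltac:(lia) ltac:(lia); have := xy n m ltac:(lia) ltac:(lia).
  by have := hyp 1 (x' n) (x n) (y m); rewrite (gpC gS 1 (x' n) (x n)); lia.
exists y; split=> //.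
  exists (h + delta)%N, (maxn n0 (maxn n1 n2)) => n k nn kk.
  have [h1 h2] := hP n k ltac:(lia) ltac:(lia); have := xy' n n ltac:(lia) ltac:(lia).
  have := hyp 1 (x' n) (y n) (r1 k); have := hyp 1 (x' n) (y n) (r2 k); lia.
exists (rho + delta)%N => w [n3 wy]; apply: rhoP; exists (maxn n3 (maxn n1 n2)) => n nn.
have := wy n ltac:(lia); have := xy' n n ltac:(lia) ltac:(lia).
by have := hyp 1 w (y n) (x' n); rewrite (gpC gS 1 (y n)); lia.
Qed.

Let A := side (fun w => linked S U z0 w).
Let B := side (fun w => ~ linked S U z0 w).

Lemma side_disjoint (p : M) : A p -> ~ B p.
Proof.
move=> [x [px _ [rho xA]]] [y [py _ [rho' yB]]].
have [n0 xx] := val_asymptotic2 gS hyp px px rho.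
have [n1 xy] := val_asymptotic2 gS hyp px py rho'.
pose n := maxn n0 n1; apply: (yB (x n)).
  by exists n1 => k kk; apply: xy; lia.
by apply: xA; exists n0 => k kk; apply: xx; lia.
Qed.

Lemma side_cover (p : M) x : val p x -> avoids x -> A p \/ B p.
Proof.
move=> px ax; have [rho nU] := near_unobstructed oz0 ax.
have nl := near_linked nU.
have [n0 xn] := near_seq (rho + 2 * delta) (val_asymptotic gS px).
have [zx|nzx] := EM (linked S U z0 (x n0)); [left|right]; exists x; split=> //;
    exists (rho + 2 * delta)%N => w wx.
  exact: linked_trans zx (nl _ _ (xn n0 (leqnn _)) wx).
by move=> zw; apply: nzx; apply: linked_trans zw (nl _ _ wx (xn n0 (leqnn _))).
Qed.

Lemma side_avoids (p : M) x : val p x -> A p \/ B p -> avoids x.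
Proof.
move=> px; case=> -[y [py [h [n0 hP]] _]];
  have [n1 xy] := val_asymptotic2 gS hyp px py (h + delta).+1;
  exists (h + delta)%N, (maxn n0 n1) => n k nn kk;
  have [h1 h2] := hP n k ltac:(lia) ltac:(lia);
  have := xy n n ltac:(lia) ltac:(lia); rewrite (gpC gS);
  have := hyp 1 (y n) (x n) (r1 k); have := hyp 1 (y n) (x n) (r2 k); lia.
Qed.

(** Two points are wanted rather than one: if the rays [r1] and [r2] have the same end, one of them
    joins it in the cut pair and the other remains on its side. *)
Lemma escape_points z : out z -> exists p p' : M, [/\ p <> p',
  exists2 x, val p x & avoids x /\ exists n0, forall n, (n0 <= n)%N -> linked S U z (x n) &
  exists2 x, val p' x & avoids x /\ exists n0, forall n, (n0 <= n)%N -> linked S U z (x n)].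
Proof.
move=> oz.
have [i [j [ij Wi]]] : exists i j, (i < j < 4)%N /\
    forall k, k \in [:: i; j] -> W (fun t => forall n, (gp z (z * xi k n) (q1 t) <= c + delta)%N /\
       (gp z (z * xi k n) (q2 t) <= c + delta)%N).
  have /choice[f fP] : forall t, exists ij : nat * nat, (ij.1 < ij.2 < 4)%N /\
     forall k n, k \in [:: ij.1; ij.2] ->
      (gp z (z * xi k n) (q1 t) <= c + delta)%N /\ (gp z (z * xi k n) (q2 t) <= c + delta)%N.
    by move=> t; have [i [j ij]] := free_directions gS hyp gxixi z (q1 t) (q2 t); exists (i, j).
  (* The pair of free directions varies with [t] among six; the ultrafilter fixes one. *)
  have [|[i j] _ Wf] := @ultra_choice W _ f [:: (0, 1); (0, 2); (0, 3); (1, 2); (1, 3); (2, 3)]%N uW.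
    apply: (ultra_sub uW _ (ultra_ge uW 0)) => t _; have [ij _] := fP t.
    by move: ij; rewrite !inE; case: (f t) => [i j] /= ij; rewrite !xpair_eqE; lia.
  exists i, j; have [t ft] := ultra_ex uW Wf; split; first by have [] := fP t; rewrite ft.
  move=> k kij; apply: (ultra_sub uW _ Wf) => u fu n.
  by have [_] := fP u; rewrite fu; apply.
have zz k n m : (gp 1 (z * xi k n) (z * xi k m) + (2 * d 1 z + delta) >= 2 * minn n m)%N.
  have := gp_base gS z 1 (z * xi k n) (z * xi k m); have := gxi k n m.
  by have := gp_mul S z 1 (xi k n) (xi k m); rewrite mulg1 (distC gS z 1); lia.
have as_ k : asymptotic S (fun n => z * xi k n) (fun n => z * xi k n).
  by move=> h; exists (h + (2 * d 1 z + delta))%N => n m nn mm; have := zz k n m; lia.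
have good k : k \in [:: i; j] -> exists2 p : M, val p (fun n => z * xi k n) &
    avoids (fun n => z * xi k n) /\ forall n, linked S U z (z * xi k n).
  move=> kij; have [p pP] := boundary_point_ex gS (as_ k); exists p => //; split.
    exists (c + 3 * delta + 2 * d 1 z)%N, (c + 3 * delta + 2 * d 1 z).+1 => n l nn ll.
    have [_ W1] := r1P l; have [_ W2] := r2P l.
    have [t [kt [t1 t2]]] := ultra_ex uW (ultra_and uW (Wi k kij) (ultra_and uW W1 W2)).
    have [k1 k2] := kt n.
    have := gp_base gS 1 z (z * xi k n) (q1 t); have := gp_base gS 1 z (z * xi k n) (q2 t).
    have := hyp 1 (z * xi k n) (r1 l) (q1 t); have := hyp 1 (z * xi k n) (r2 l) (q2 t).
    by rewrite t1 t2; lia.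
  (* Here is the origin of the slack [c + 3 * delta + 1]: the product with [q] costs
     [c + 2 * delta], and the gap between consecutive points of the ray costs [delta + 1]. *)
  have low v n : (d v (z * xi k n) <= delta + 1)%N -> U v.
    move=> vn; have Wall := ultra_and uW (ultra_and uW (Wi k kij) oz) (ultra_ge uW (c + 2 * delta + 2 * d 1 z).+1).
    apply: (ultra_sub uW _ Wall) => t [[kt zt] tbig] q Qq.
    have [k1 k2] := kt n.
    have small : (gp z (z * xi k n) q <= c + 2 * delta)%N.
      case: (spot Qq) => tq.
        have := hyp z (z * xi k n) q (q1 t); have := gp_base gS 1 z q (q1 t); lia.
      have := hyp z (z * xi k n) q (q2 t); have := gp_base gS 1 z q (q2 t); lia.
    have := zt q Qq; have := gpE gS z (z * xi k n) q; rewrite dist_mulr dxi.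
    have := dist_tri gS (z * xi k n) v q; rewrite (distC gS _ v).
    have := dist_tri gS z (z * xi k n) q; rewrite dist_mulr dxi; lia.
  elim=> [|n IHn].
    have -> : z * xi k 0%N = z.
      by rewrite -(dist_eq0 gS (dxi k 0%N)) mulg1.
    apply: linked0; apply: (low _ 0%N).
    by rewrite dist_mulr dxi.
  apply: linked_trans IHn _; apply: (linked_geodesic gS) => v nvn; apply: (low v n).
  rewrite (distC gS v); apply: leq_trans (_ : (d (z * xi k n) (z * xi k n.+1) <= _)%N).
    by lia.
  rewrite dist_mul; have := gpE gS 1 (xi k n) (xi k n.+1); have := gxi k n n.+1.
  by rewrite !dxi; lia.
have [p pv [pa pl]] := good i ltac:(by rewrite inE eqxx).
have [p' pv' [pa' pl']] := good j ltac:(by rewrite !inE eqxx orbT).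
exists p, p'; split; last first.
- by exists (fun n => z * xi j n) => //; split=> //; exists 0%N.
- by exists (fun n => z * xi i n) => //; split=> //; exists 0%N.
move=> pp; rewrite pp in pv; have [n0 nP] := val_asymptotic2 gS hyp pv pv' (c + 2 * d 1 z).+1.
have := nP n0 n0 (leqnn _) (leqnn _); have := gp_base gS 1 z (z * xi i n0) (z * xi j n0).
by have := gxixi n0 n0 ij; have := gp_mul S z 1 (xi i n0) (xi j n0); rewrite mulg1; lia.
Qed.

Variable z1 : G.
Hypotheses (oz1 : out z1) (sep : ~ linked S U z0 z1).

Lemma limit_cut_pair : exists a b : M, cut_pair a b.
Proof.
have [a av] := boundary_point_ex gS (ray_asymptotic r1P).
have [b bv] := boundary_point_ex gS (ray_asymptotic r2P).
have toA p x : val p x -> avoids x -> (exists n0, forall n, (n0 <= n)%N -> linked S U z0 (x n)) -> A p.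
  move=> px ax [n0 zx]; case: (side_cover px ax) => // -[y [py _ [rho yB]]].
  have [n1 xy] := val_asymptotic2 gS hyp px py rho.
  case: (yB (x (maxn n0 n1))); last by apply: zx; lia.
  by exists n1 => k kk; apply: xy; lia.
have toB p x : val p x -> avoids x -> (exists n0, forall n, (n0 <= n)%N -> linked S U z1 (x n)) -> B p.
  move=> px ax [n0 zx]; case: (side_cover px ax) => // -[y [py _ [rho yA]]].
  have [n1 xy] := val_asymptotic2 gS hyp px py rho.
  have z0x : linked S U z0 (x (maxn n0 n1)) by apply: yA; exists n1 => k kk; apply: xy; lia.
  by case: sep; apply: linked_trans z0x (linked_sym gS (zx _ _)); lia.
have [pA [pA' [pAA [x xv [xa xl]] [x' xv' [xa' xl']]]]] := escape_points oz0.
have [pB [_ [_ [y yv [ya yl]] _]]] := escape_points oz1.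
have cover p : A p \/ B p <-> p <> a /\ p <> b.
  have [u pu] := val_ex p; split.
    move=> /(side_avoids pu)[h [n0 hP]]; split=> pe; rewrite pe in pu.
      have [n1 ua] := val_asymptotic2 gS hyp pu av h.+1.
      by have [+ _] := hP (maxn n0 n1) (maxn n0 n1) ltac:(lia) ltac:(lia);
        have := ua (maxn n0 n1) (maxn n0 n1) ltac:(lia) ltac:(lia); lia.
    have [n1 ua] := val_asymptotic2 gS hyp pu bv h.+1.
    by have [_ +] := hP (maxn n0 n1) (maxn n0 n1) ltac:(lia) ltac:(lia);
      have := ua (maxn n0 n1) (maxn n0 n1) ltac:(lia) ltac:(lia); lia.
  move=> [pna pnb]; apply: (side_cover pu).
  have uu := val_asymptotic gS pu.
  have [|h1 [n1 hP1]] := asymptotic_bound hyp uu (ray_asymptotic r1P).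
    by move=> ua; apply: pna; apply: (point_eq gS hyp pu av ua).
  have [|h2 [n2 hP2]] := asymptotic_bound hyp uu (ray_asymptotic r2P).
    by move=> ub; apply: pnb; apply: (point_eq gS hyp pu bv ub).
  exists (maxn h1 h2), (maxn n1 n2) => n k nn kk.
  by have := hP1 n k ltac:(lia) ltac:(lia); have := hP2 n k ltac:(lia) ltac:(lia); lia.
have Ap : A pA by apply: toA xv xa xl.
have Ap' : A pA' by apply: toA xv' xa' xl'.
have Bp : B pB by apply: toB yv ya yl.
(* If the limit points coincide, the single point [a] already separates, and [pA] is removed from
   its side, where [pA'] is left. *)
have [ab|ab] := EM (a = b); last first.
  exists a, b; apply: (@cut_pair_of_partition _ _ a b A B) => //; try exact: open_side.
  - by exists pA.
  - by exists pB.
  - exact: side_disjoint.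
exists a, pA; apply: (@cut_pair_of_partition _ _ a pA (setD A [set pA]%classic) B) => //.
- by move=> ap; case: ((cover pA).1 (or_introl Ap)) => /(_ (esym ap)).
- exact/(open_setD1 gS hyp)/open_side.
- exact: open_side.
- by exists pA'; split=> // pp; apply: pAA.
- by exists pB.
- by move=> p [/side_disjoint].
- move=> p; split=> [[[pAp pn]|pBp]|[pna pnA]].
  + by have [] := (cover p).1 (or_introl pAp).
  + split; first by have [] := (cover p).1 (or_intror pBp).
    by move=> pp; rewrite pp in pBp; apply: side_disjoint pBp.
  + by have [|pAp|pBp] := (cover p).2 _; [rewrite -ab|left|right].
Qed.

End LimitCutPair.

Section Connect.
Variables (G : groupType) (S : seq G).
Hypothesis gS : generating S.
Variables (delta : nat) (hyp : hyp4 S delta).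
Hypothesis nocut : ~ exists a b : gromov_boundary S, cut_pair a b.
Local Notation d := (dist S).
Local Notation gp := (gp2 S).
Variables (c : nat) (xi : nat -> nat -> G).
Hypotheses (dxi : forall i n, d 1 (xi i n) = n)
  (gxi : forall i m n, (2 * minn m n <= gp 1 (xi i m) (xi i n) + delta)%N)
  (gxixi : forall i j m n, (i < j < 4)%N -> (gp 1 (xi i m) (xi j n) <= c)%N).

Lemma linked_mul g (P : G -> Prop) x y :
  linked S P x y -> linked S (fun w => P (g^-1 * w)) (g * x) (g * y).
Proof.
elim=> [Px|u v _ IH uv Pv]; first by apply: linked0; rewrite mulKg.
by apply: linkedS IH _ _; rewrite ?dist_mul ?mulKg.
Qed.

(* If the conclusion failed for all [M] and [T], the complements of the balls
   would converge to a disconnected subset of the group, whose two sides would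
   accumulate on the two sides of a cut pair. *)
Lemma connect : connectable S (c + 3 * delta + 1).
Proof.
move=> m.
(* Translating [x] to 1 confines [z] and [z'] to a finite ball, which the limit requires. *)
suff [M [T MT]] : exists M T, forall (Q : G -> Prop) N z z', two_spotted S T 1 Q ->
  (d 1 z <= m)%N -> (d 1 z' <= m)%N ->
  (forall q, Q q -> (N + (c + 3 * delta + 1) <= d z q)%N) ->
  (forall q, Q q -> (N + (c + 3 * delta + 1) <= d z' q)%N) ->
  linked S (fun w => (d 1 w <= M)%N /\ forall q, Q q -> (N <= d w q)%N) z z'.
  exists M, T => x Q N z z' [q1 [q2 [f1 f2 spot]]] xz xz' Qz Qz'.
  have dV u v : d (x^-1 * u) v = d u (x * v) by rewrite -(dist_mul S x) mulVKg.
  have d1V u : d 1 (x^-1 * u) = d x u by rewrite -(dist_mul S x) mulg1 mulVKg.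
  rewrite -(mulVKg x z) -(mulVKg x z').
  apply: (@linked_sub _ _ (fun w => (d 1 (x^-1 * w) <= M)%N /\
      forall q, Q (x * q) -> (N <= d (x^-1 * w) q)%N)).
    move=> w [w1 wQ]; split; first by rewrite -d1V.
    by move=> q; rewrite -{1}(mulVKg x q) => /wQ; rewrite dV mulVKg.
  apply: (linked_mul x (P := fun w => (d 1 w <= M)%N /\ forall q, Q (x * q) -> (N <= d w q)%N)).
  apply: MT; rewrite ?d1V //.
  - exists (x^-1 * q1), (x^-1 * q2); rewrite !d1V; split=> // q /spot.
    by rewrite -!(gp_mul S x 1) !mulg1 !mulVKg.
  - by move=> q /Qz; rewrite dV.
  - by move=> q /Qz'; rewrite dV.
apply: contrapT => no; apply: nocut.
have /choice[f fP] : forall j, exists f : (G -> Prop) * nat * G * G * G * G,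
    let: (Q, N, z, z', q1, q2) := f in
    [/\ (j <= d 1 q1)%N /\ (j <= d 1 q2)%N,
       forall q, Q q -> (j <= gp 1 q q1)%N \/ (j <= gp 1 q q2)%N,
       (d 1 z <= m)%N /\ (d 1 z' <= m)%N,
       (forall q, Q q -> (N + (c + 3 * delta + 1) <= d z q)%N) /\
       (forall q, Q q -> (N + (c + 3 * delta + 1) <= d z' q)%N) &
       ~ linked S (fun w => (d 1 w <= j)%N /\ forall q, Q q -> (N <= d w q)%N) z z'].
  move=> j; apply: contrapT => noj; apply: no; exists j, j.
  move=> Q N z z' [q1 [q2 [f1 f2 spot]]] z1 z1' Qz Qz'; apply: contrapT => nl.
  by apply: noj; exists (Q, N, z, z', q1, q2).
pose Q j := (f j).1.1.1.1.1; pose N j := (f j).1.1.1.1.2; pose z j := (f j).1.1.1.2.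
pose z' j := (f j).1.1.2; pose q1 j := (f j).1.2; pose q2 j := (f j).2.
have {}fP j : [/\ (j <= d 1 (q1 j))%N /\ (j <= d 1 (q2 j))%N,
       forall q, Q j q -> (j <= gp 1 q (q1 j))%N \/ (j <= gp 1 q (q2 j))%N,
       (d 1 (z j) <= m)%N /\ (d 1 (z' j) <= m)%N,
       (forall q, Q j q -> (N j + (c + 3 * delta + 1) <= d (z j) q)%N) /\
       (forall q, Q j q -> (N j + (c + 3 * delta + 1) <= d (z' j) q)%N) &
       ~ linked S (fun w => (d 1 w <= j)%N /\ forall q, Q j q -> (N j <= d w q)%N) (z j) (z' j)].
  by have := fP j; rewrite /Q /N /z /z' /q1 /q2; case: (f j) => [[[[[]]]]].
have [W uW] := exists_ultra.
have [|z0 Wz0] := ultra_ball gS uW (f := z) (n := m).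
  by apply: (ultra_sub uW _ (ultra_ge uW 0)) => j _; have [_ _ [? _] _ _] := fP j.
have [|z1 Wz1] := ultra_ball gS uW (f := z') (n := m).
  by apply: (ultra_sub uW _ (ultra_ge uW 0)) => j _; have [_ _ [_ ?] _ _] := fP j.
have [|r1 r1P] := ultra_ray gS uW (q := q1).
  move=> n; apply: (ultra_sub uW _ (ultra_ge uW n)) => j nj.
  by have [[jq _] _ _ _ _] := fP j; apply: leq_trans jq.
have [|r2 r2P] := ultra_ray gS uW (q := q2).
  move=> n; apply: (ultra_sub uW _ (ultra_ge uW n)) => j nj.
  by have [[_ jq] _ _ _ _] := fP j; apply: leq_trans jq.
apply: (limit_cut_pair gS hyp dxi gxi gxixi uW (Q := Q) (N := N) (q1 := q1) (q2 := q2)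
  _ r1P r2P (z0 := z0) _ (z1 := z1) _).
- by move=> j q; have [_ spot _ _ _] := fP j; apply: spot.
- by apply: (ultra_sub uW _ Wz0) => j <-; have [_ _ _ [? _] _] := fP j.
- by apply: (ultra_sub uW _ Wz1) => j <-; have [_ _ _ [_ ?] _] := fP j.
(* A path in [U] has finitely many vertices, so for most [j] all of them satisfy the conditions of
   index [j]. *)
move=> l01; suff Wl : W (fun j => linked S
    (fun w => (d 1 w <= j)%N /\ forall q, Q j q -> (N j <= d w q)%N) z0 z1).
  have [j [lj [zj z'j]]] := ultra_ex uW (ultra_and uW Wl (ultra_and uW Wz0 Wz1)).
  by have [_ _ _ _] := fP j; rewrite zj z'j.
elim: l01 => [Uz0|u v _ IH uv Uv].
  apply: (ultra_sub uW _ (ultra_and uW Uz0 (ultra_ge uW (d 1 z0)))) => j [? ?].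
  exact: linked0.
apply: (ultra_sub uW _ (ultra_and uW IH (ultra_and uW Uv (ultra_ge uW (d 1 v))))).
by move=> j [lj [? ?]]; apply: linkedS lj uv _.
Qed.

End Connect.

(** * Cochains with small coboundary *)

Section Cochains.
Variables (G : groupType) (S : seq G).
Hypothesis gS : generating S.
Variables (delta : nat) (hyp : hyp4 S delta).
Local Notation d := (dist S).
Local Notation gp := (gp2 S).

Lemma two_spotted_sub T T' x (Q : G -> Prop) :
  (T' <= T)%N -> two_spotted S T x Q -> two_spotted S T' x Q.
Proof.
move=> TT [q1 [q2 [f1 f2 spot]]]; exists q1, q2; split; try lia.
by move=> q /spot[h|h]; [left|right]; lia.
Qed.

(* A point far from [P] and from the centers of the triples of [P] sees at most
   two of the ends of the tree approximating [P]. *)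
Lemma center_closure (P : seq G) : exists Q, [/\ {subset P <= Q},
  (size Q <= size P + size P ^ 3)%N &
  forall T x, (0 < size P)%N -> (forall q, q \in Q -> (T + 3 * delta + 1 <= d x q)%N) ->
    two_spotted S T x (fun q => q \in Q)].
Proof.
have /choice[cen cenP] : forall t : G * G * G, exists c,
    [/\ (gp c t.1.1 t.1.2 <= 2 * delta + 2)%N, (gp c t.1.1 t.2 <= 2 * delta + 2)%N
      & (gp c t.1.2 t.2 <= 2 * delta + 2)%N].
  by move=> t; apply: exists_center.
exists (P ++ [seq cen (p, w) | p <- [seq (u, v) | u <- P, v <- P], w <- P]); split.
- by move=> x xP; rewrite mem_cat xP.
- by rewrite size_cat !size_allpairs leq_add2l; nia.
move=> T x sP far.
have cenQ u v w : u \in P -> v \in P -> w \in P ->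
    cen (u, v, w) \in P ++ [seq cen (p, w) | p <- [seq (u, v) | u <- P, v <- P], w <- P].
  move=> uP vP wP; rewrite mem_cat; apply/orP; right.
  by apply: allpairs_f => //; apply: allpairs_f.
have pair c0 u v : (T + 3 * delta + 1 <= d x c0)%N -> (gp c0 u v <= 2 * delta + 2)%N ->
    (T + 2 * delta <= gp x u c0)%N \/ (T + 2 * delta <= gp x v c0)%N.
  move=> xc cuv; have := gpE gS x u c0; have := gpE gS x v c0; have := gpE gS c0 u v.
  have := dist_tri gS x u v; have := distC gS u c0; have := distC gS v c0.
  have := gpE gS x u v; lia.
have three u v w : u \in P -> v \in P -> w \in P -> (T + delta <= gp x u v)%N \/
    (T + delta <= gp x u w)%N \/ (T + delta <= gp x v w)%N.
  move=> uP vP wP; have [/= uv uw vw] := cenP (u, v, w).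
  have xc := far _ (cenQ _ _ _ uP vP wP).
  have := pair _ _ _ xc uv; have := pair _ _ _ xc uw; have := pair _ _ _ xc vw.
  set z := cen (u, v, w).
  have := hyp x u z v; have := hyp x u z w; have := hyp x v z w.
  rewrite (gpC gS x z v) (gpC gS x z w); lia.
case: P sP far cenQ three pair => [//|a P0] _ far cenQ three pair; set P := a :: P0 in far cenQ three *.
have aP : a \in P by rewrite mem_head.
have farP p : p \in P -> (T + 3 * delta + 1 <= d x p)%N by move=> pP; apply: far; rewrite mem_cat pP.
(* [a] is one end. The other is any point of [P] in a different direction; if there is none, [a]
   serves twice. *)
have [b bP spot] : exists2 b, b \in P & forall p, p \in P ->
    (T + delta <= gp x p a)%N \/ (T + delta <= gp x p b)%N.
  have [[b bP ab]|all_a] := EM (exists2 b, b \in P & (gp x a b < T + delta)%N).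
    exists b => // p pP; have := three _ _ _ aP bP pP.
    by rewrite (gpC gS x p a) (gpC gS x p b); lia.
  exists a => // p pP; left; rewrite leqNgt; apply/negP => lt.
  by apply: all_a; exists p; rewrite // (gpC gS).
exists a, b; split; [have := farP a aP; lia|have := farP b bP; lia|].
move=> q qQ; have [qP|qP] := boolP (q \in P).
  by have := spot q qP; lia.
have [u [v [uP vP qE]]] : exists u v, [/\ u \in P, v \in P & exists2 w, w \in P & q = cen (u, v, w)].
  move: (qQ); rewrite mem_cat (negPf qP) orFb => /allpairsPdep[p [w [/allpairsPdep[u [v [uP vP ->]]] wP ->]]].
  by exists u, v; split=> //; exists w.
case: qE => w wP qE; have [/= uv _ _] := cenP (u, v, w); rewrite -qE in uv.
have [uq|vq] := pair _ _ _ (far q qQ) uv.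
  have := spot u uP; have := hyp x q u a; have := hyp x q u b; rewrite (gpC gS x q u); lia.
have := spot v vP; have := hyp x q v a; have := hyp x q v b; rewrite (gpC gS x q v); lia.
Qed.

(** Pigeonhole: the quotients of the entries by [e] cannot fill [size s + 1] values. *)
Lemma distance_gap e (s : seq nat) : (0 < e)%N -> exists2 r, (r <= size s)%N &
  forall x, x \in s -> (x < r * e)%N || (r.+1 * e <= x)%N.
Proof.
move=> e0; apply: contrapT => no.
have sub : {subset iota 0 (size s).+1 <= [seq x %/ e | x <- s]}.
  move=> r; rewrite mem_iota add0n ltnS /= => rs; apply: contrapT => nr; apply: no; exists r => // x xs.
  have [//|le] := ltnP x (r * e); rewrite /= leqNgt; apply/negP => lt.
  apply: nr; apply/mapP; exists x => //.
  by apply/eqP; rewrite eq_sym eqn_leq -ltnS ltn_divLR // lt leq_divRL.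
by have := uniq_leq_size (iota_uniq _ _) sub; rewrite size_iota size_map ltnn.
Qed.

Import GRing.Theory.
Implicit Types (al : G -> G -> int).

Definition closed_at al rho u := forall v w, (d u v <= rho)%N -> (d u w <= rho)%N ->
  (d v w <= rho)%N -> (al u v + al v w = al u w)%R.

(* Integrating along geodesics issued from 1: nearby geodesics fellow-travel. *)
Lemma closed_exact al rho e : (2 * delta + 2 * e + 1 <= rho)%N ->
  (forall u v, al u v = - al v u)%R -> (forall u, closed_at al rho u) ->
  exists B : G -> int, forall u v, (d u v <= e)%N -> al u v = (B v - B u)%R.
Proof.
move=> erho anti closed.
have /choice[c cP] : forall v, exists c, [/\ c 0%N = 1, c (d 1 v) = v & geodesic S (d 1 v) c].
  by move=> v; apply: exists_geodesic.
pose cl v t := c v (minn t (d 1 v)).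
have cl_step v t : (d (cl v t) (cl v t.+1) <= 1)%N.
  by have [_ _ geo] := cP v; rewrite geo; lia.
pose I v t := (\sum_(s < t) al (cl v s) (cl v s.+1))%R.
have alxx u : al u u = 0%R by have := anti u u; lia.
have I_end v t : (d 1 v <= t)%N -> I v t = I v (d 1 v).
  move=> vt; rewrite -(subnKC vt) /I; elim: (t - d 1 v)%N => [|n IHn]; first by rewrite addn0.
  rewrite addnS big_ord_recr /= IHn -[RHS]addr0; congr (_ + _)%R.
  by rewrite /cl !(minn_idPr _) ?alxx //; lia.
exists (fun v => I v (d 1 v)) => u v uv.
have close t : (d (cl u t) (cl v t) <= 2 * delta + 2 * e)%N.
  have [u0 un geou] := cP u; have [v0 vn geov] := cP v.
  pose s := minn t (minn (d 1 u) (d 1 v)).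
  have du : d 1 (c u s) = s by have := geou 0%N s; rewrite u0 subn0; apply; lia.
  have dv : d 1 (c v s) = s by have := geov 0%N s; rewrite v0 subn0; apply; lia.
  have gu : gp 1 (c u s) u = (2 * s)%N.
    by have := gpE gS 1 (c u s) u; have := geou s (d 1 u) ltac:(lia); rewrite un du; lia.
  have gv : gp 1 (c v s) v = (2 * s)%N.
    by have := gpE gS 1 (c v s) v; have := geov s (d 1 v) ltac:(lia); rewrite vn dv; lia.
  have guv := gpE gS 1 u v; have t1 := dist_tri gS 1 u v; have t2 := dist_tri gS 1 v u.
  have h1 := hyp 1 (c u s) u v; have h2 := hyp 1 (c u s) v (c v s).
  rewrite (gpC gS 1 v (c v s)) gv gu in h1 h2; rewrite (distC gS v u) in t2.
  have ss : (d (c u s) (c v s) <= 2 * delta + e)%N.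
    by have := gpE gS 1 (c u s) (c v s); rewrite du dv; lia.
  have us : d (cl u t) (c u s) = (minn t (d 1 u) - s)%N.
    by rewrite (distC gS) /cl geou; lia.
  have vs : d (c v s) (cl v t) = (minn t (d 1 v) - s)%N by rewrite /cl geov; lia.
  have := dist_tri gS (cl u t) (c u s) (cl v t); have := dist_tri gS (c u s) (c v s) (cl v t).
  by rewrite us vs; lia.
(* The two geodesics are compared rung by rung; each square of the ladder is cut into two triangles,
   to which closedness applies. *)
have ladder t : (I u t + al (cl u t) (cl v t) = I v t)%R.
  elim: t => [|t IHt].
    rewrite /I !big_ord0 /cl !min0n; have [-> _ _] := cP u; have [-> _ _] := cP v.
    by rewrite alxx.
  have t1 := closed (cl u t) (cl u t.+1) (cl v t.+1).
  have t2 := closed (cl u t) (cl v t) (cl v t.+1).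
  have := dist_tri gS (cl u t) (cl v t) (cl v t.+1).
  have := close t; have := close t.+1; have := cl_step u t; have := cl_step v t => s1 s2 s3 s4 s5.
  rewrite /I !big_ord_recr /= -/(I u t) -/(I v t).
  by have := t1 ltac:(lia) ltac:(lia) ltac:(lia); have := t2 ltac:(lia) ltac:(lia) ltac:(lia); lia.
pose t := maxn (d 1 u) (d 1 v); have := ladder t.
rewrite !I_end ?/t; try lia.
rewrite /cl !(minn_idPr _); try lia.
by have [_ -> _] := cP u; have [_ -> _] := cP v; lia.
Qed.

End Cochains.

(** * Exactness off a finite set and sums along paths *)

Section LineSum.
Variables (G : groupType) (S : seq G).
Hypothesis gS : generating S.
Variables (delta : nat) (hyp : hyp4 S delta).
Local Notation d := (dist S).
Local Notation gp := (gp2 S).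
Import GRing.Theory.

Variable slack : nat.
Hypotheses (esc : escapable S) (con : connectable S slack).

Let off (Q : seq G) N x := all (fun q => (N <= d x q)%N) Q.

(* A cochain of bounded support which is closed at all points of the complement
   of a ball neighbourhood of [Q] is exact there: push each point away from [Q],
   where the primitive is already known by downward induction. *)
Lemma exact_off e : (0 < e)%N -> exists rho0 R, forall rho, (rho0 <= rho)%N ->
  forall (al : G -> G -> int) (P Q : seq G) n, (0 < size Q)%N ->
  (forall T x, off Q (T + 3 * delta + 1) x -> two_spotted S T x (fun q => q \in Q)) ->
  {subset P <= Q} ->
  (forall u v, (d u v <= rho)%N -> al u v != 0%R -> (d 1 u <= n)%N) ->
  (forall u, u \notin P -> closed_at S al rho u) ->
  exists (A : G -> int) n', (forall u, A u != 0%R -> (d 1 u <= n')%N) /\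
    forall u v, off Q R u -> off Q R v -> (d u v <= e)%N -> al u v = (A v - A u)%R.
Proof.
move=> e0; have [T1 [m0 escP]] := esc slack.+1.
have [M [T2 conP]] := con (m0 + e).
pose T := maxn T1 T2; pose R := (T + 3 * delta + 1)%N.
exists (M + m0 + e + 1)%N, R => rho rho0 al P Q n sQ spots PQ supp closed.
have notP N x : (R <= N)%N -> off Q N x -> x \notin P.
  move=> RN /allP xQ; apply/negP => /PQ/xQ; rewrite distxx //; lia.
have spot N x : (R <= N)%N -> off Q N x -> two_spotted S T x (fun q => q \in Q).
  move=> RN /allP xQ; apply: spots; apply/allP => q /xQ; rewrite -/R; lia.
have /choice[f fP] : forall x, exists x', two_spotted S T x (fun q => q \in Q) ->
    (d x x' <= m0)%N /\ forall q, q \in Q -> (d x q + slack.+1 <= d x' q)%N.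
  move=> x; have [sx|nsx] := EM (two_spotted S T x (fun q => q \in Q)); last by exists x.
  have [|x' xx' Qx'] := escP x (fun q => q \in Q).
    by apply: two_spotted_sub sx; rewrite leq_maxl.
  by exists x'.
suff ind k N : N = (R + k)%N -> (exists (A : G -> int) n', (forall u, A u != 0%R -> (d 1 u <= n')%N) /\
      forall u v, off Q N u -> off Q N v -> (d u v <= e)%N -> al u v = (A v - A u)%R) ->
    exists (A : G -> int) n', (forall u, A u != 0%R -> (d 1 u <= n')%N) /\
      forall u v, off Q R u -> off Q R v -> (d u v <= e)%N -> al u v = (A v - A u)%R.
  case: Q sQ {spots} PQ notP spot f fP ind => [//|q0 Q0] _ PQ notP spot f fP ind.
  (* So far from [q0] the cochain vanishes, and the zero function starts the downward induction. *)
  apply: (ind (n + d 1 q0).+1 _ erefl); exists (fun=> 0%R), 0%N; split=> [u|u v uQ vQ uv].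
    by rewrite eqxx.
  apply/eqP; rewrite subr0; apply: contraT => /supp uvn.
  have := uvn ltac:(lia); move: uQ => /= /andP[uq _].
  by have := dist_tri gS u 1 q0; rewrite (distC gS u 1); lia.
elim: k N => [|k IHk] N NE; first by rewrite addn0 in NE; rewrite NE.
move=> [A [n' [An' AP]]]; apply: (IHk (R + k)%N erefl).
pose N' := (R + k)%N; have NN' : N = N'.+1 by rewrite NE addnS.
have fN x : off Q N' x -> (d x (f x) <= m0)%N /\ off Q (N + slack) (f x).
  move=> xQ; have [|xf fQ] := fP x; first by apply: spot xQ; rewrite /N'; lia.
  split=> //; apply/allP => q qQ; have := fQ q qQ; move/allP: xQ => /(_ q qQ); lia.
(* The value at [x] is read off at the pushed point [f x] through a single value of [al]. Each level
   moves the support by at most [m0], so it stays bounded. *)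
exists (fun x => if off Q N' x then A (f x) - al x (f x) else 0)%R, (n + n' + m0)%N; split.
  move=> u; case: ifP => [uN|]; last by rewrite eqxx.
  have [uf _] := fN u uN; have [->|Afu _] := eqVneq (A (f u)) 0%R.
    rewrite sub0r oppr_eq0 => /supp h; have := h ltac:(lia); lia.
  by have := An' _ Afu; have := dist_tri gS 1 (f u) u; rewrite (distC gS (f u)); lia.
move=> u v uN vN uv; rewrite uN vN.
have [uf fu] := fN u uN; have [vf fv] := fN v vN.
have cu : closed_at S al rho u by apply: closed; apply: notP uN; rewrite /N'; lia.
have lnk : linked S (fun w => (d u w <= M)%N /\ forall q, q \in Q -> (N <= d w q)%N) (f u) (f v).
  apply: conP; first by apply: two_spotted_sub (spot _ _ _ uN); rewrite ?leq_maxr //; rewrite /N'; lia.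
  - by lia.
  - by have := dist_tri gS u v (f v); lia.
  - by move=> q qQ; move/allP: fu; apply.
  - by move=> q qQ; move/allP: fv; apply.
(* The path from [f u] to [f v] stays off [Q] and within [rho] of [u]. Closedness at [u] alone
   therefore shows that pushing [u] to [f u] or to [f v] gives the same value. *)
have along w : linked S (fun w => (d u w <= M)%N /\ forall q, q \in Q -> (N <= d w q)%N) (f u) w ->
    al u w = (A w - A (f u) + al u (f u))%R.
  elim=> [_|y z uy IHy yz [uz zN]]; first by lia.
  have [_ [uyM yN]] := linked_end uy.
  have yQ : off Q N y by apply/allP.
  have zQ : off Q N z by apply/allP.
  have := cu y z ltac:(lia) ltac:(lia) ltac:(lia).
  by rewrite (AP _ _ yQ zQ ltac:(lia)) IHy; lia.
have tri := dist_tri gS u v (f v).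
have := along _ lnk; have := cu v (f v) ltac:(lia) ltac:(lia) ltac:(lia); lia.
Qed.

(* The primitive [A] of [al] off a neighbourhood of the centers of [P] leaves a
   residue [be] near those centers. A gap in the distances from [P] separates the
   part of the residue near [P], which the path avoids, from the rest, which is
   closed everywhere and hence exact. *)
Lemma path_sum : exists rho0, forall rho, (rho0 <= rho)%N -> forall k, exists D,
  forall (al : G -> G -> int) (P : seq G) n, (size P <= k)%N ->
  (forall u v, al u v = - al v u)%R ->
  (forall u v, (d u v <= rho)%N -> al u v != 0%R -> (d 1 u <= n)%N) ->
  (forall u, u \notin P -> closed_at S al rho u) ->
  exists n', forall (p : nat -> G) l,
    (forall t, (t < l)%N -> (d (p t) (p t.+1) <= 2)%N) ->
    (forall t q, (t <= l)%N -> q \in P -> (D < d (p t) q)%N) ->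
    linked S (fun z => (n' < d 1 z)%N) (p 0%N) (p l) ->
    (\sum_(t < l) al (p t) (p t.+1) = 0)%R.
Proof.
pose e := (2 * delta + 5)%N.
have epos : (0 < e)%N by rewrite /e; lia.
have [rho0 [R ex]] := exact_off epos.
exists (rho0 + e)%N => rho rhoP k.
pose E := (2 * R + 3 * e + 1)%N; pose K := (k.+1 + k.+1 ^ 3)%N.
(* The index of the gap is at most [k * K], so centers on the near side of it are within [k * K * E]
   of [P], and the residue around them is [R + e] away at most. Below, 1 is added to [P] to keep the
   list nonempty. *)
exists (k * K * E + R + e)%N => al P n Pk anti supp closed.
have [Q [PQ sQ spots]] := center_closure gS hyp (1 :: P).
have QK : (size Q <= K)%N.
  by apply: leq_trans sQ _; rewrite /K leq_add //= leq_exp2r.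
have [|||||A [nA [suppA AP]]] := ex rho ltac:(lia) al P Q n.
- by case: Q PQ {sQ spots QK} => // /(_ 1); rewrite mem_head => /(_ isT).
- by move=> T x /allP xQ; apply: spots.
- by move=> x xP; apply: PQ; rewrite inE xP orbT.
- exact: supp.
- exact: closed.
have Epos : (0 < E)%N by rewrite /E; lia.
have [r rP gap] := distance_gap [seq d p q | p <- P, q <- Q] Epos.
rewrite size_allpairs in rP.
pose Z q := has (fun p => (d p q < r * E)%N) P.
have gapP p q : p \in P -> q \in Q -> ~~ Z q -> (r * E + E <= d p q)%N.
  move=> pP qQ /hasPn/(_ p pP) npq; have := gap (d p q) _.
  by rewrite allpairs_f // (negPf npq) /= mulSn addnC; apply.
pose be u v := (al u v - (A v - A u))%R.
have be_anti u v : be u v = (- be v u)%R by rewrite /be (anti u v); lia.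
have be_closed u : u \notin P -> closed_at S be rho u.
  by move=> uP v w uv uw vw; have := closed u uP v w uv uw vw; rewrite /be; lia.
have be_near u v : (d u v <= e)%N -> be u v != 0%R -> exists q,
    [/\ q \in Q, (d u q <= R + e)%N & (d v q <= R + e)%N].
  move=> uv nz; apply: contrapT => no; case/eqP: nz; rewrite /be (AP u v) ?subrr //.
    apply/allP => q qQ; rewrite leqNgt; apply/negP => lt; apply: no; exists q; split=> //; first by lia.
    by have := dist_tri gS v u q; rewrite (distC gS v u); lia.
  apply/allP => q qQ; rewrite leqNgt; apply/negP => lt; apply: no; exists q; split=> //; last by lia.
  by have := dist_tri gS u v q; lia.
pose far u := has (fun q => (d u q <= R + e)%N) [seq q <- Q | ~~ Z q].
have farP u : far u -> exists q, [/\ q \in Q, ~~ Z q & (d u q <= R + e)%N].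
  by case/hasP=> q; rewrite mem_filter => /andP[nZ qQ] uq; exists q.
have farI u q : q \in Q -> ~~ Z q -> (d u q <= R + e)%N -> far u.
  by move=> qQ nZ uq; apply/hasP; exists q; rewrite // mem_filter nZ.
have farNP u : far u -> u \notin P.
  move=> /farP[q [qQ nZ uq]]; apply/negP => uP; have := gapP u q uP qQ nZ; rewrite /E; lia.
have farZ u q : far u -> q \in Q -> (d u q <= R + e)%N -> ~~ Z q.
  move=> /farP[q' [q'Q nZ' uq']] qQ uq; apply/negP => /hasP[p pP pq].
  have := gapP p q' pP q'Q nZ'; have := dist_tri gS p q q'; have := dist_tri gS q u q'.
  by rewrite (distC gS q u) /E; lia.
have far_be u v : (d u v <= e)%N -> far u -> ~~ far v -> be u v = 0%R.
  move=> uv uf vnf; apply/eqP; apply: contraT => /(be_near u v uv)[q [qQ uq vq]].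
  by case/negP: vnf; apply: farI qQ (farZ _ _ uf qQ uq) vq.
(* The part of the residue beyond the gap. By the width [E], it neither meets [P] nor interacts with
   the near part, so it is closed everywhere. *)
pose ga u v := if far u then be u v else 0%R.
have gaE u v : (d u v <= e)%N -> far v -> ga u v = be u v.
  move=> uv vf; rewrite /ga; case: ifP => // /negbT nuf.
  by rewrite be_anti far_be ?oppr0 // (distC gS).
(* Away from pairs at distance at most [e], the restriction [ga] need not be antisymmetric; hence
   the truncation. *)
have [|||B BP] := closed_exact gS hyp (al := fun u v => if (d u v <= e)%N then ga u v else 0%R) (rho := e) (e := 2).
- by rewrite /e; lia.
- move=> u v; rewrite (distC gS v u); case: ifP => uv; last by rewrite oppr0.
  have [vf|vnf] := boolP (far v); first by rewrite gaE // /ga vf be_anti.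
  rewrite {2}/ga (negPf vnf) oppr0 /ga; case: ifP => // uf; exact: far_be.
- move=> u v w uv uw vw; rewrite uv uw vw.
  have [uf|unf] := boolP (far u).
    have cu := be_closed u (farNP u uf) v w ltac:(lia) ltac:(lia) ltac:(lia).
    have [vf|vnf] := boolP (far v); first by rewrite /ga uf vf.
    rewrite /ga uf (negPf vnf) addr0 far_be //.
    have [wf|wnf] := boolP (far w); last by rewrite far_be.
    rewrite -cu far_be // add0r be_anti far_be ?oppr0 //.
    by rewrite (distC gS).
  rewrite /ga (negPf unf) add0r; case: ifP => // vf.
  have vu : be v u = 0%R by apply: far_be => //; rewrite (distC gS).
  have cv := be_closed v (farNP v vf) u w ltac:(rewrite (distC gS); lia) ltac:(lia) ltac:(lia).
  have [wf|wnf] := boolP (far w); last by rewrite far_be.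
  by rewrite -cv vu add0r be_anti far_be ?oppr0 // (distC gS).
have [nQ QnQ] := seq_bound S Q.
exists (nA + nQ + R + 2 * e)%N => p l step away ends.
have AE u : (nA < d 1 u)%N -> A u = 0%R.
  by move=> lt; apply/eqP; apply: contraT => /suppA; lia.
have [e0 el] := linked_end ends.
(* [B] need not vanish at infinity; it is only constant along paths far from 1. This is why the ends
   of [p] must be linked there. *)
have const u : linked S (fun z => (nA + nQ + R + 2 * e < d 1 z)%N) (p 0%N) u -> B u = B (p 0%N).
  elim=> // y z _ IHy yz zfar.
  suff : (B z = B y)%R by move->.
  have := BP z y ltac:(rewrite (distC gS); lia); rewrite (distC gS z y) ifT; last by lia.
  rewrite /ga; case: ifP => [|_]; last by lia.
  move=> /farP[q [qQ _ zq]]; have := QnQ q qQ; have := dist_tri gS 1 q z.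
  by rewrite (distC gS q z); lia.
have beB t : (t < l)%N -> al (p t) (p t.+1) =
    ((A (p t.+1) + B (p t.+1)) - (A (p t) + B (p t)))%R.
  move=> tl; have st := step t tl.
  suff beE : be (p t) (p t.+1) = (B (p t.+1) - B (p t))%R by move: beE; rewrite /be; lia.
  have := BP (p t) (p t.+1) st; rewrite ifT; last by lia.
  rewrite /ga; case: ifP => // /negbT pnf <-; apply/eqP; apply: contraT.
  have ste : (d (p t) (p t.+1) <= e)%N by lia.
  move=> /(be_near _ _ ste)[q [qQ pq _]].
  have [/hasP[p' p'P p'q]|nZ] := boolP (Z q); last first.
    by case/negP: pnf; apply: farI qQ nZ pq.
  have := away t p' ltac:(lia) p'P; have := dist_tri gS (p t) q p'; rewrite (distC gS q p').
  have : (r * E <= k * K * E)%N by rewrite leq_mul2r (leq_trans rP) ?orbT // leq_mul.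
  lia.
have tele j : (j <= l)%N -> (\sum_(t < j) al (p t) (p t.+1) =
    (A (p j) + B (p j)) - (A (p 0%N) + B (p 0%N)))%R.
  elim: j => [_|j IHj jl]; first by rewrite big_ord0 subrr.
  by rewrite big_ord_recr /= IHj ?beB; lia.
by rewrite tele // !AE ?const //; lia.
Qed.

End LineSum.

(** * Colorings and greedy choices *)

(** The colors are the values in a product of finite quotients, one for each nontrivial element of
    [B]. *)
Lemma separating_coloring (G : groupType) (B : seq G) : residually_finite G ->
  exists (C : finType) (color : G -> C), forall u b, b \in B -> b != 1 ->
    color (u * b) != color u.
Proof.
move=> rf; elim: B => [|a B [C [color colorP]]]; first by exists unit, (fun=> tt).
have [-> | a1] := eqVneq a 1.
  exists C, color => u b; rewrite inE => /orP[/eqP ->|]; last exact: colorP.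
  by rewrite eqxx.
have [H [f fa]] := rf a a1; exists (C * H)%type, (fun u => (color u, f u)) => u b.
rewrite inE xpair_eqE negb_and => /orP[/eqP -> _|bB b1]; last by rewrite colorP.
rewrite gmulfM; apply/orP; right; apply: contra fa => /eqP fua.
by apply/eqP; apply: (mulgI (f u)); rewrite fua mulg1.
Qed.

Lemma popular_color (C : finType) (T : Type) (color : T -> C) (s : seq T) :
  (0 < #|C|)%N -> exists a, (size s <= #|C| * count (fun x => color x == a) s)%N.
Proof.
move=> C0; apply: contrapT => no.
have sum_count : (\sum_(a : C) count (fun x => color x == a) s = size s)%N.
  elim: s {no} => [|x s IHs] /=; first by rewrite big1.
  rewrite big_split /= IHs (bigD1 (color x)) //= eqxx big1 // => a.
  by rewrite eq_sym => /negPf ->.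
have lt a : (#|C| * count (fun x => color x == a) s < size s)%N.
  by rewrite ltnNge; apply/negP => le; apply: no; exists a.
have [a0 _] := card_gt0P C0.
have s0 : (0 < size s)%N by apply: leq_ltn_trans (lt a0).
have : (\sum_(a : C) #|C| * count (fun x => color x == a) s <= \sum_(a : C) (size s).-1)%N.
  by apply: leq_sum => a _; rewrite -ltnS prednK.
rewrite -big_distrr /= sum_count sum_nat_const leq_pmul2l //; lia.
Qed.

(* Items enter at level [depth] and each of them is killed by one of the [#|C|]
   values of the color used at every lower level. As at most [K] items enter at
   each level, a greedy choice of the colors keeps at most [K * #|C|] alive. *)
Lemma greedy_colors (C : finType) (T : eqType) (s : seq T) (depth : T -> nat) (K : nat)
    (alive : (nat -> C) -> T -> nat -> bool) : (0 < #|C|)%N ->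
  (forall r, (count (fun x => depth x == r) s <= K)%N) ->
  (forall i i' x k, (forall l, (k < l)%N -> i l = i' l) -> alive i x k = alive i' x k) ->
  (forall i x k, (k < depth x)%N -> alive i x k -> alive i x k.+1) ->
  (forall i x k, (k < depth x)%N -> exists a, forall i',
    (forall l, (k.+1 < l)%N -> i l = i' l) -> i' k.+1 = a -> ~~ alive i' x k) ->
  exists i, forall k, (0 < k)%N ->
    (count (fun x => (k <= depth x)%N && alive i x k) s <= K * #|C|)%N.
Proof.
move=> C0 depthK ext mono kill; have [a0 _] := card_gt0P C0.
pose R := (\max_(x <- s) depth x).+1.
have depthR x : x \in s -> (depth x < R)%N by move=> xs; rewrite ltnS leq_bigmax_seq.
suff ind n : exists i, forall k, (R - n <= k)%N ->
    (count (fun x => (k <= depth x)%N && alive i x k) s <= K * #|C|)%N.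
  by have [i iP] := ind R; exists i => k k0; apply: iP; lia.
elim: n => [|n [i iP]].
  exists (fun=> a0) => k Rk; rewrite (@eq_in_count _ _ pred0) ?count_pred0 // => x xs /=.
  by have := depthR x xs; case: leqP => //; lia.
have [Rn|nR] := leqP R n; first by exists i => k _; apply: iP; lia.
pose k := (R - n.+1)%N.
pose live := [seq x <- s | (k.+1 <= depth x)%N && alive i x k.+1].
have /choice[col colP] : forall x, exists a, (k < depth x)%N -> forall i',
    (forall l, (k.+1 < l)%N -> i l = i' l) -> i' k.+1 = a -> ~~ alive i' x k.
  move=> x; have [lt|] := ltnP k (depth x); last by exists a0.
  by have [a aP] := kill i x k lt; exists a.
(* The most frequent killing color removes a fraction [1 / #|C|] of the living items, at most
   [K * #|C|] in number. This makes room for the [K] new ones. *)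
have [a liveP] := popular_color col live C0.
pose i' l := if l == k.+1 then a else i l.
have ii' l : (k.+1 < l)%N -> i l = i' l by rewrite /i'; case: eqP => //; lia.
exists i' => l; rewrite leq_eqVlt => /orP[/eqP <-|lt]; last first.
  rewrite (@eq_count _ _ (fun x => (l <= depth x)%N && alive i x l)); last first.
    by move=> x /=; congr (_ && _); apply: ext => m lm; rewrite ii' //; rewrite /k in lt *; lia.
  by apply: iP; rewrite /k; lia.
rewrite -/k; have := iP k.+1 ltac:(lia); rewrite -size_filter -/live => liveK.
have split_count : (count (fun x => (k <= depth x) && alive i' x k) s <=
    count (fun x => depth x == k) s + count (fun x => col x != a) live)%N.
  rewrite count_filter; elim: (s) => //= x s' IH.
  have [dk|kd|dk] := ltngtP (depth x) k => /=; first by lia.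
    suff : (alive i' x k <= (col x != a) && alive i x k.+1)%N by lia.
    have [al|] := boolP (alive i' x k) => //=.
    have -> : alive i x k.+1 by rewrite (@ext i i') //; apply: mono.
    have [ca|//] := eqVneq (col x) a.
    by have := colP x kd i' ii'; rewrite al; apply; rewrite /i' eqxx.
  by lia.
apply: leq_trans split_count _; have := depthK k.
have := count_predC (fun x => col x == a) live.
rewrite (@eq_count _ (predC (fun x => col x == a)) (fun x => col x != a)) //.
by set n1 := count _ live; set n2 := count _ live; set n3 := count _ s; rewrite -/n1 in liveP; nia.
Qed.

(** * Directions *)

Section Trajectories.
Variables (G : groupType) (S : seq G).
Hypothesis gS : generating S.
Variables (delta : nat) (hyp : hyp4 S delta).
Local Notation d := (dist S).
Local Notation gp := (gp2 S).
Local Notation J := (4 * delta + 1)%N.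

Variables (C : finType) (color : G -> C).
Hypothesis colorP : forall u v,
  (d u v <= 2 * (J + delta))%N -> u <> v -> color u <> color v.

Let below (v u : G) := (d 1 u + J = d 1 v)%N /\ (d u v <= J + delta)%N.

(** Points below the same [v] are within [2 * (J + delta)] of each other, so at most one of them has
    color [a]. If there is none, a point on a geodesic to 1 is the default. *)
Lemma exists_descent : exists desc : C -> G -> G, forall a v, (J <= d 1 v)%N ->
  below v (desc a v) /\ forall u, below v u -> color u = a -> desc a v = u.
Proof.
suff /choice[f fP] : forall av : C * G, exists w, (J <= d 1 av.2)%N ->
    below av.2 w /\ forall u, below av.2 u -> color u = av.1 -> w = u.
  by exists (fun a v => f (a, v)) => a v; apply: (fP (a, v)).
move=> [a v] /=; have [Jv|_] := leqP J (d 1 v); last by exists 1.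
have [[w wv wa]|no] := EM (exists2 w, below v w & color w = a).
  exists w => _; split=> // u uv ua; apply: contrapT => wu.
  apply: (@colorP w u) => //; last by rewrite wa ua.
  have [_ h1] := wv; have [_ h2] := uv; have := dist_tri gS w v u.
  by rewrite (distC gS v u); lia.
have [w [w1 wv]] := dist_split gS (leq_subr J (d 1 v)).
exists w => _; split; first by split; lia.
by move=> u uv ua; case: no; exists u.
Qed.

Variable desc : C -> G -> G.
Hypothesis descP : forall a v, (J <= d 1 v)%N ->
  below v (desc a v) /\ forall u, below v u -> color u = a -> desc a v = u.

Variable top : G -> G.
Hypothesis topP : forall v, d 1 (top v) = (d 1 v %/ J * J)%N /\
  gp 1 (top v) v = (2 * (d 1 v %/ J * J))%N.

(** All trajectories use the same color [i l] to descend from level [l] to the next lower one;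
    levels are the multiples of [J]. *)
Fixpoint fall (i : nat -> C) (v : G) (t : nat) : G :=
  if t is t'.+1 then desc (i (d 1 v %/ J - t')%N) (fall i v t') else top v.

Definition at_level i v k := fall i v (d 1 v %/ J - k).

Lemma at_levelS i v k : (k < d 1 v %/ J)%N ->
  at_level i v k = desc (i k.+1) (at_level i v k.+1).
Proof.
move=> lt; rewrite /at_level subnS -[in LHS](@prednK (d 1 v %/ J - k)) ?subn_gt0 //=.
by congr (desc (i _) _); lia.
Qed.

(** The error stays at [2 * delta] however long the descent: going down by [J] absorbs the error of
    the level above. *)
Lemma at_levelP i v k : (k <= d 1 v %/ J)%N ->
  d 1 (at_level i v k) = (k * J)%N /\ (2 * (k * J) <= gp 1 (at_level i v k) v + 2 * delta)%N.
Proof.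
move=> kn; rewrite -(subKn kn); elim: (d 1 v %/ J - k)%N (leq_subr k (d 1 v %/ J)) => [|t IHt] tn.
  by rewrite subn0 /at_level subnn /=; have [-> ->] := topP v; split; lia.
have [lt1 lt2] := IHt ltac:(lia); set m := (d 1 v %/ J - t.+1)%N.
have mE : (d 1 v %/ J - t)%N = m.+1 by rewrite /m; lia.
rewrite mE in lt1 lt2; rewrite at_levelS; last by rewrite /m; lia.
set w := at_level i v m.+1 in lt1 lt2 *.
have [|[uw1 uw2] _] := descP (i m.+1) (v := w); first by rewrite lt1 mulSn; lia.
rewrite lt1 mulSn in uw1 lt2; split; first by lia.
have := hyp 1 (desc (i m.+1) w) w v; have := gpE gS 1 (desc (i m.+1) w) w.
by rewrite lt1 mulSn; lia.
Qed.

Lemma at_level_ext i i' v k : (forall l, (k < l)%N -> i l = i' l) ->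
  at_level i v k = at_level i' v k.
Proof.
rewrite /at_level => ii'.
have : (d 1 v %/ J - k <= d 1 v %/ J - k)%N by [].
elim: {1 3 4}(d 1 v %/ J - k)%N => [//|t IHt] tk /=.
by rewrite IHt ?ii' //; lia.
Qed.

Lemma at_level_close i v w k : (2 * (k * J) <= gp 1 v w)%N ->
  [/\ (k <= d 1 v %/ J)%N, (k <= d 1 w %/ J)%N
    & (d (at_level i v k) (at_level i w k) <= 4 * delta)%N].
Proof.
move=> vw; have lv := gp_le_dist gS 1 v w; have lw := gp_le_dist gS 1 w v.
rewrite (gpC gS) in lw.
have kv : (k <= d 1 v %/ J)%N by rewrite leq_divRL //; lia.
have kw : (k <= d 1 w %/ J)%N by rewrite leq_divRL //; lia.
have [v1 v2] := at_levelP i kv; have [w1 w2] := at_levelP i kw; split=> //.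
have := hyp 1 (at_level i v k) v w; have := hyp 1 (at_level i v k) w (at_level i w k).
have := gpE gS 1 (at_level i v k) (at_level i w k); rewrite (gpC gS 1 w (at_level i w k)) v1 w1.
lia.
Qed.

(** At level [k.+1] the trajectories are so close that a point below one of them on a geodesic to 1
    is also below the other. Its color sends both to it. *)
Lemma at_level_merge i v w k : (2 * (k.+1 * J) <= gp 1 v w)%N ->
  exists a, forall i', (forall l, (k.+1 < l)%N -> i l = i' l) -> i' k.+1 = a ->
    at_level i' v k = at_level i' w k.
Proof.
move=> vw; have [kv kw close] := at_level_close i vw.
have [v1 _] := at_levelP i kv; have [w1 _] := at_levelP i kw.
set v' := at_level i v k.+1 in close v1 *; set w' := at_level i w k.+1 in close w1 *.
have [|u [u1 uv]] := @dist_split _ _ gS 1 v' (k * J); first by rewrite v1 mulSn; lia.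
have bv : below v' u by split; [rewrite u1 v1 mulSn; lia|rewrite uv v1 mulSn; lia].
have bw : below w' u.
  split; first by rewrite u1 w1 mulSn; lia.
  have := hyp 1 u v' w'; have := gpE gS 1 u v'; have := gpE gS 1 u w'.
  have := gpE gS 1 v' w'; rewrite uv u1 v1 w1 mulSn; lia.
exists (color u) => i' ii' i'a; rewrite (at_levelS i' kv) (at_levelS i' kw).
have -> : at_level i' v k.+1 = v' by apply/esym/at_level_ext.
have -> : at_level i' w k.+1 = w' by apply/esym/at_level_ext.
have [|_ dv] := descP (i' k.+1) (v := v'); first by rewrite v1 mulSn; lia.
have [|_ dw] := descP (i' k.+1) (v := w'); first by rewrite w1 mulSn; lia.
by rewrite (dv u bv (esym i'a)) (dw u bw (esym i'a)).
Qed.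

(** The descent from [a] towards [x], stopped at distance [J] from [x]; a point closer than [J] gets
    the direction [x]. Computing it at 1 makes it equivariant. *)
Definition dir i x a : G := x * at_level i (x^-1 * a) 1.

Lemma dir_mul i g x a : dir i (g * x) (g * a) = g * dir i x a.
Proof. by rewrite /dir invgM -!mulgA mulKg. Qed.

Lemma gp1V x a b : gp 1 (x^-1 * a) (x^-1 * b) = gp x a b.
Proof. by rewrite -(gp_mul S x) mulg1 !mulVKg. Qed.

Lemma dist1V x a : d 1 (x^-1 * a) = d x a.
Proof. by rewrite -(dist_mul S x) mulg1 mulVKg. Qed.

Lemma dir_opposite i x a b : (4 * delta < d (dir i x a) (dir i x b))%N -> (gp x a b < 2 * J)%N.
Proof.
move=> opp; rewrite ltnNge; apply/negP => ab.
have [|_ _] := @at_level_close i (x^-1 * a) (x^-1 * b) 1; first by rewrite gp1V mul1n.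
by move: opp; rewrite /dir dist_mul; lia.
Qed.

Lemma opposite_dir i x a b : gp x a b = 0%N -> (J <= d x a)%N -> (J <= d x b)%N ->
  (4 * delta < d (dir i x a) (dir i x b))%N.
Proof.
move=> ab ax bx; rewrite /dir dist_mul.
have [|u1 u2] := @at_levelP i (x^-1 * a) 1; first by rewrite dist1V divn_gt0 ?ax ?bx // addn1.
have [|v1 v2] := @at_levelP i (x^-1 * b) 1; first by rewrite dist1V divn_gt0 ?ax ?bx // addn1.
set u := at_level i _ 1 in u1 u2 *; set v := at_level i _ 1 in v1 v2 *.
have := hyp 1 (x^-1 * a) u v; have := hyp 1 (x^-1 * a) v (x^-1 * b).
by rewrite gp1V ab (gpC gS 1 (x^-1 * a) u); have := gpE gS 1 u v; rewrite u1 v1; lia.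
Qed.

(* Along a leg of a tripod, the point [x] is determined up to bounded distance by
   the Gromov product [gp x b c]. *)
Lemma leg_position a b c x x' r :
  (gp x a b < 2 * J)%N -> (gp x a c < 2 * J + delta)%N ->
  (gp x' a b < 2 * J)%N -> (gp x' a c < 2 * J + delta)%N ->
  (gp x b c %/ (2 * J) = r)%N -> (gp x' b c %/ (2 * J) = r)%N ->
  (d x x' <= 5 * J + 2 * delta)%N.
Proof.
move=> ab ac ab' ac' rE rE'.
have : (gp x b c < gp x' b c + 2 * J)%N /\ (gp x' b c < gp x b c + 2 * J)%N.
  have := divn_eq (gp x b c) (2 * J); have := divn_eq (gp x' b c) (2 * J).
  have J2 : (0 < 2 * J)%N by lia.
  have := ltn_pmod (gp x b c) J2; have := ltn_pmod (gp x' b c) J2.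
  rewrite rE rE'; lia.
have := gpE gS x a b; have := gpE gS x a c; have := gpE gS x b c.
have := gpE gS x' a b; have := gpE gS x' a c; have := gpE gS x' b c.
have := hyp a x b x'; have := gpE gS a x x'; have := gpE gS a x b; have := gpE gS a b x'.
rewrite (distC gS x' b) (distC gS x b) (distC gS b x') (distC gS x' a) (distC gS x a); lia.
Qed.

End Trajectories.

(** * Direction systems with few singular points *)

Section DirectionSystem.
Variables (G : groupType) (S : seq G).
Hypothesis gS : generating S.
Variables (delta : nat) (hyp : hyp4 S delta) (rf : residually_finite G).
Local Notation d := (dist S).
Local Notation gp := (gp2 S).
Local Notation J := (4 * delta + 1)%N.

(** At a bad [x], which lies on a leg of the tripod, say that of [a], the trajectories of [b] and
    [c] have not merged although they run close together as long as [gp x b c] permits. The colors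
    are chosen greedily after [Tr] so that few such [x] survive; only the bound is uniform. *)
Lemma direction_system : exists K : nat -> nat, forall Tr : seq (G * G * G),
  exists (di : G -> G -> G) (X : seq G), [/\ (size X <= K (size Tr))%N,
    forall g x a, di (g * x) (g * a) = g * di x a,
    forall x a b, (4 * delta < d (di x a) (di x b))%N -> (gp x a b < 2 * J)%N,
    forall x a b, gp x a b = 0%N -> (J <= d x a)%N -> (J <= d x b)%N ->
      (4 * delta < d (di x a) (di x b))%N &
    forall a b c x, (a, b, c) \in Tr ->
      di x a <> di x b -> di x a <> di x c -> di x b <> di x c ->
      [\/ (4 * delta < d (di x a) (di x b))%N, (4 * delta < d (di x a) (di x c))%N
        | (4 * delta < d (di x b) (di x c))%N] -> x \in X].
Proof.
have [B BP] := ball_finite gS (2 * (J + delta)).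
have [C [color sepC]] := separating_coloring B rf.
have colorP u v : (d u v <= 2 * (J + delta))%N -> u <> v -> color u <> color v.
  move=> uv nuv; have := sepC u (u^-1 * v) (BP _ uv); rewrite mulVKg => ne.
  apply/eqP; rewrite eq_sym ne //; apply/eqP => uv1; apply: nuv.
  by rewrite -(mulVKg u v) uv1 mulg1.
have C0 : (0 < #|C|)%N by apply/card_gt0P; exists (color 1).
have [desc descP] := exists_descent gS colorP.
have /choice[top topP] : forall v, exists u, d 1 u = (d 1 v %/ J * J)%N /\
    gp 1 u v = (2 * (d 1 v %/ J * J))%N.
  move=> v; have [u [u1 uv]] := dist_split gS (leq_divM (d 1 v) J).
  by exists u; split=> //; have := gpE gS 1 u v; have := leq_divM (d 1 v) J; lia.
have [Bs BsP] := ball_finite gS (5 * J + 2 * delta).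
(* The factor 6 counts the orders of a triple, [size Bs] the positions of a given depth on a leg,
   and [#|C| + 1] the survivors at level 1 together with the items of depth 0. *)
exists (fun n => 6 * n * size Bs * (#|C| + 1))%N => Tr.
pose perms (t : G * G * G) : seq (G * G * G) := let: (a, b, c) := t in
  [:: (a, b, c); (b, a, c); (a, c, b); (b, c, a); (c, a, b); (c, b, a)].
pose PT := flatten [seq perms t | t <- Tr].
have sPT : size PT = (6 * size Tr)%N.
  rewrite /PT; elim: (Tr) => //= -[[a b] c] s IHs; rewrite size_cat IHs /= mulnS //.
pose cond (t : G * G * G) x := (gp x t.1.1 t.1.2 < 2 * J)%N && (gp x t.1.1 t.2 < 2 * J + delta)%N.
have /choice[XL XLP] : forall t, exists XL : seq G, uniq XL /\ XL =i cond t.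
  move=> t; have [s sP] := ball_finite gS (d t.1.1 t.1.2 + 2 * J).
  exists (undup [seq x <- [seq t.1.1 * y | y <- s] | cond t x]); split; first exact: undup_uniq.
  move=> x; rewrite mem_undup mem_filter; apply/andP/idP => [[]//|xc]; split=> //.
  apply/mapP; exists (t.1.1^-1 * x); last by rewrite mulVKg.
  apply: sP; rewrite -/(d t.1.1 x) (distC gS); case/andP: xc => xc _.
  by have := gpE gS x t.1.1 t.1.2; lia.
pose depth (e : (G * G * G) * G) := (gp e.2 e.1.1.2 e.1.2 %/ (2 * J))%N.
pose lev := at_level S delta desc top.
pose alive i (e : (G * G * G) * G) k := lev i (e.2^-1 * e.1.1.2) k != lev i (e.2^-1 * e.1.2) k.
pose items := [seq (t, x) | t <- PT, x <- XL t].
have itemsP t x : t \in PT -> cond t x -> (t, x) \in items.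
  by move=> tP tx; apply/allpairsPdep; exists t, x; split=> //; have [_ ->] := XLP t.
have depthK r : (count (fun e => depth e == r) items <= size PT * size Bs)%N.
  rewrite /items; elim: (PT) => //= t s IHs; rewrite count_cat mulSn leq_add //.
  rewrite count_map -size_filter.
  set F := [seq x <- _ | _]; have FP x : x \in F -> cond t x /\ depth (t, x) = r.
    by rewrite mem_filter /= => /andP[/eqP dx]; have [_ ->] := XLP t.
  have uF : uniq F by rewrite filter_uniq //; have [] := XLP t.
  case: F FP uF => // x0 F0 FP uF.
  rewrite -(size_map (mulg x0) Bs); apply: uniq_leq_size => // x xF.
  apply/mapP; exists (x0^-1 * x); last by rewrite mulVKg.
  apply: BsP; have [/andP[ab ac] dr] := FP x xF.
  have [/andP[ab0 ac0] dr0] := FP x0 (mem_head _ _).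
  exact: (leg_position gS hyp ab0 ac0 ab ac dr0 dr).
have J2 : (0 < 2 * J)%N by rewrite muln_gt0 addn_gt0 orbT.
have below_depth e k : (k < depth e)%N ->
    (2 * (k.+1 * J) <= gp 1 (e.2^-1 * e.1.1.2) (e.2^-1 * e.1.2))%N.
  by rewrite /depth leq_divRL // (gp1V S); lia.
have [i iP] : exists i, forall k, (0 < k)%N ->
    (count (fun e => (k <= depth e)%N && alive i e k) items <= (size PT * size Bs) * #|C|)%N.
  apply: greedy_colors => // [i i' e k ii'|i e k kd|i e k kd].
  - by rewrite /alive /lev !(@at_level_ext _ S delta C desc top i i' _ k ii').
  - have [kv kw _] := at_level_close gS hyp descP topP i (below_depth e k kd).
    by rewrite /alive /lev; apply: contra => /eqP eqk; rewrite (at_levelS _ _ _ kv) (at_levelS _ _ _ kw) eqk.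
  - have [a aP] := at_level_merge gS hyp descP topP i (below_depth e k kd).
    by exists a => i' ii' i'a; rewrite negbK; apply/eqP/aP.
pose keep e := (depth e == 0%N) || ((1 <= depth e)%N && alive i e 1%N).
pose X := [seq e.2 | e <- items & keep e].
have XP t x : t \in PT -> cond t x -> dir S delta desc top i x t.1.2 <> dir S delta desc top i x t.2 -> x \in X.
  move=> tP tx ne; apply/mapP; exists (t, x) => //; rewrite mem_filter itemsP // andbT /keep.
  case: (depth _) => //= n; apply/eqP => eq1; apply: ne; rewrite /dir; congr (_ * _); exact: eq1.
exists (dir S delta desc top i), X; split.
- rewrite size_map size_filter.
  have := count_predUI (fun e => depth e == 0%N) (fun e => (1 <= depth e)%N && alive i e 1%N) items.
  have := depthK 0%N; have := iP 1%N isT; rewrite sPT.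
  rewrite (@eq_count _ keep (predU (fun e => depth e == 0%N) (fun e => (1 <= depth e)%N && alive i e 1%N))) //.
  by set n1 := count _ _; set n2 := count _ _; set n3 := count _ _; nia.
- by move=> g x a; apply: dir_mul.
- by move=> x a b; apply: (dir_opposite gS hyp descP topP).
- by move=> x a b; apply: (opposite_dir gS hyp descP topP).
move=> a b c x tr nab nac nbc opp.
have inPT t : t \in perms (a, b, c) -> t \in PT.
  by move=> tp; apply/flattenP; exists (perms (a, b, c)) => //; apply: map_f.
(* As [x] is between [u] and [v], the point [w] is seen away from [u] or away from [v], and [x] is
   on the leg of that one. *)
have core u v w : (u, v, w) \in PT -> (v, u, w) \in PT ->
    dir S delta desc top i x v <> dir S delta desc top i x w ->
    dir S delta desc top i x u <> dir S delta desc top i x w ->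
    (4 * delta < d (dir S delta desc top i x u) (dir S delta desc top i x v))%N -> x \in X.
  move=> p1 p2 vw uw /(dir_opposite gS hyp descP topP) uv.
  have [lt|ge] := ltnP (gp x u w) (2 * J + delta); first by apply: XP p1 _ vw; rewrite /cond /= uv lt.
  apply: XP p2 _ uw; rewrite /cond /= (gpC gS) uv /=.
  by have := hyp x u w v; rewrite (gpC gS x w v); lia.
case: opp => opp.
- by apply: (core a b c) => //; apply: inPT; rewrite !inE eqxx ?orbT.
- apply: (core a c b) => //; try (by apply: inPT; rewrite !inE eqxx ?orbT).
  exact: nesym.
- by apply: (core b c a) => //; try (by apply: inPT; rewrite !inE eqxx ?orbT); apply: nesym.
Qed.

End DirectionSystem.

(** * Translation lengths *)

Section Axis.
Variables (G : groupType) (S : seq G).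
Hypothesis gS : generating S.
Variables (delta : nat) (hyp : hyp4 S delta).
Local Notation d := (dist S).
Local Notation gp := (gp2 S).

Lemma dist_expg_step h n : d (h ^+ n) (h ^+ n.+1) = d 1 h.
Proof. by rewrite expgSr dist_mulr. Qed.

(* The orbit of 1 under a long element whose square is much longer than itself is
   a local, hence a global, quasi-geodesic. *)
Lemma axis_gp h P n : gp 1 h^-1 h = P -> (P + delta < d 1 h)%N ->
  (gp 1 h^-1 (h ^+ n.+1) <= P + delta)%N.
Proof.
move=> PE long; elim: n => [|n IHn]; first by rewrite expg1 PE leq_addr.
have := hyp 1 h^-1 (h ^+ n.+2) h; have := gp_swap gS 1 h (h ^+ n.+2).
have := gp_mul S h^-1 h 1 (h ^+ n.+2); rewrite mulVg mulg1 {1}[h ^+ n.+2]expgS mulKg.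
rewrite (gpC gS 1 (h ^+ n.+2) h) PE => e1 e2 e3; move: IHn e2; rewrite e1 => {e1}. lia.
Qed.

Lemma axis_proper h P n : gp 1 h^-1 h = P -> (P + delta < d 1 h)%N -> (n <= d 1 (h ^+ n))%N.
Proof.
move=> PE long; elim: n => [//|[|n] IHn]; first by rewrite expg1; lia.
have := axis_gp n PE long; have := gpE gS 1 h^-1 (h ^+ n.+1).
have -> : d h^-1 (h ^+ n.+1) = d 1 (h ^+ n.+2).
  by rewrite -(dist_mul S h h^-1) mulgV -expgS.
have -> : d 1 h^-1 = d 1 h by rewrite !dist1 word_lengthV.
lia.
Qed.

(** Seen from [x], all later powers lie in the direction of [h]; consecutive ones then have products
    too large for opposite directions, so the axis does not cross at [x] again. *)
Lemma axis_forward h P x t n : gp 1 h^-1 h = P -> (P + delta < d 1 h)%N ->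
  d 1 x = t -> d x h = (d 1 h - t)%N -> (t <= d 1 h)%N ->
  (P + 8 * delta + 2 + 3 * delta <= 2 * (d 1 h - t))%N ->
  (2 * (4 * delta + 1) <= gp x (h ^+ n.+1) (h ^+ n.+2))%N.
Proof.
move=> PE long xt xh th far.
have close m : (2 * (4 * delta + 1) + delta <= gp x h (h ^+ m.+1))%N.
  case: m => [|m]; first by rewrite expg1 gpxx // xh; lia.
  have e : gp h 1 (h ^+ m.+2) = gp 1 h^-1 (h ^+ m.+1).
    by rewrite -(gp_mul S h 1) mulg1 mulgV -expgS.
  have h1 : (gp h 1 (h ^+ m.+2) <= P + delta)%N by rewrite e; apply: axis_gp.
  have h2 : gp h 1 x = (2 * (d 1 h - t))%N.
    by have := gpE gS h 1 x; rewrite (distC gS h 1) (distC gS h x) xh xt; lia.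
  have := hyp h 1 x (h ^+ m.+2); rewrite (gpC gS h 1 (h ^+ _)) (gpC gS h _ 1) h2.
  by have := gp_swap gS x h (h ^+ m.+2); rewrite xh; lia.
by have := hyp x (h ^+ n.+1) h (h ^+ n.+2); rewrite (gpC gS x _ h);
  have := close n; have := close n.+1; lia.
Qed.

Lemma axis_backward h P x t n : gp 1 h^-1 h = P -> (P + delta < d 1 h)%N ->
  d 1 x = t -> d x h = (d 1 h - t)%N -> (t <= d 1 h)%N ->
  (P + 8 * delta + 2 + 3 * delta <= 2 * t)%N ->
  (2 * (4 * delta + 1) <= gp x (h^-1 ^+ n.+1) (h^-1 ^+ n))%N.
Proof.
move=> PE long xt xh th far.
have PE' : gp 1 (h^-1)^-1 h^-1 = P by rewrite invgK (gpC gS).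
have long' : (P + delta < d 1 h^-1)%N by rewrite dist1 word_lengthV // -dist1.
have x1 : d x 1 = t by rewrite (distC gS).
have close m : (2 * (4 * delta + 1) + delta <= gp x 1 (h^-1 ^+ m))%N.
  case: m => [|m]; first by rewrite expg0 gpxx // x1; lia.
  have := axis_gp m PE' long'; rewrite invgK => h1.
  have h2 : gp 1 h x = (2 * t)%N by have := gpE gS 1 h x; rewrite (distC gS h x) xh xt; lia.
  have := hyp 1 h x (h^-1 ^+ m.+1); rewrite h2.
  by have := gp_swap gS x 1 (h^-1 ^+ m.+1); rewrite x1; lia.
by have := hyp x (h^-1 ^+ n.+1) 1 (h^-1 ^+ n); rewrite (gpC gS x _ 1);
  have := close n; have := close n.+1; lia.
Qed.

End Axis.

Lemma morph1 (G : groupType) (phi : G -> G) : {morph phi : x y / x * y} -> phi 1 = 1.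
Proof. by move=> phiM; apply: (mulgI (phi 1)); rewrite -phiM !mulg1. Qed.

Lemma morphV (G : groupType) (phi : G -> G) :
  {morph phi : x y / x * y} -> forall x, phi x^-1 = (phi x)^-1.
Proof. by move=> phiM x; apply/esym/mulg1_eq; rewrite -phiM mulgV morph1. Qed.

Lemma automorphism_conj (G : groupType) (phi : G -> G) z :
  automorphism phi -> automorphism (fun x => phi x ^ z).
Proof.
move=> [phiM [f fK Kf]]; split; first by move=> x y; rewrite phiM conjMg.
by exists (fun x => f (x ^ z^-1)) => x; rewrite ?conjgK ?fK ?Kf ?conjgKV.
Qed.

Section Crossing.
Variables (T : eqType) (p p' : T).
Import GRing.Theory.

Definition crossing (a b : T) : int :=
  (((a == p) && (b == p'))%:Z - ((a == p') && (b == p))%:Z)%R.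

Lemma crossing_anti a b : (crossing a b = - crossing b a)%R.
Proof. by rewrite /crossing opprB (andbC (b == p)) (andbC (b == p')). Qed.

Lemma crossingxx a : crossing a a = 0%R.
Proof. by rewrite /crossing (andbC (a == p)) subrr. Qed.

Lemma crossing_neq0 a b : crossing a b != 0%R -> (a = p /\ b = p') \/ (a = p' /\ b = p).
Proof.
have [/andP[/eqP-> /eqP->] _|n1] := boolP ((a == p) && (b == p')); first by left.
have [/andP[/eqP-> /eqP->] _|n2] := boolP ((a == p') && (b == p)); first by right.
by rewrite /crossing (negPf n1) (negPf n2) subrr eqxx.
Qed.

Lemma crossing_closed (a b c : T) :
  (a <> b -> a <> c -> b <> c -> [/\ crossing a b = 0, crossing b c = 0 & crossing a c = 0]%R) ->
  (crossing a b + crossing b c = crossing a c)%R.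
Proof.
move=> abc; have [->|ab] := eqVneq a b; first by rewrite crossingxx add0r.
have [->|bc] := eqVneq b c; first by rewrite crossingxx addr0.
have [->|ac] := eqVneq a c; first by rewrite crossingxx (crossing_anti c b) addNr.
by have [-> -> ->] := abc (elimN eqP ab) (elimN eqP ac) (elimN eqP bc).
Qed.

End Crossing.

Section TranslationBound.
Variables (G : groupType) (S : seq G).
Hypothesis gS : generating S.
Variables (delta : nat) (hyp : hyp4 S delta) (oe : one_ended S) (rf : residually_finite G).
Local Notation d := (dist S).
Local Notation gp := (gp2 S).
Local Notation J := (4 * delta + 1)%N.
Import GRing.Theory.

Variable slack : nat.
Hypotheses (esc : escapable S) (con : connectable S slack).

Lemma translation_bound : exists K, forall phi : G -> G,
  automorphism phi ->
  forall g, (d 1 g <= 2)%N -> (d 1 (phi g * phi g)%g <= d 1 (phi g) + K)%N.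
Proof.
have [rho sum0] := path_sum gS hyp esc con; have {sum0} sum0 := sum0 rho (leqnn _).
have [B BP] := ball_finite gS rho.
have [K KP] := direction_system gS hyp rf; pose k := K (size B * size B)%N.
have [D sumD] := sum0 k; have [BD BDP] := ball_finite gS D.
pose m := (size BD * k)%N.
(* Since [d 1 h - P] is the excess of the length of [h ^+ 2] over that of [h], this leaves [m + 1]
   consecutive middle positions, one more than the [m] available exceptional points. *)
exists (2 * J + 3 * delta + m + 2)%N => phi [phiM [psi phiK psiK]] g g2.
rewrite leqNgt; apply/negP => long.
have phi1 := morph1 phiM; have phiV := morphV phiM.
have phiX u n : phi (u ^+ n) = phi u ^+ n.
  by elim: n => [|n IHn]; rewrite ?expg0 // !expgS phiM IHn.
set h := phi g in long; pose P := gp 1 h^-1 h.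
have h1 : d 1 h^-1 = d 1 h by rewrite !dist1 word_lengthV.
have hh : d h^-1 h = d 1 (h * h) by rewrite -(dist_mul S h h^-1) mulgV.
have PE := gpE gS 1 h^-1 h; rewrite h1 hh -/P in PE.
have axis : (P + delta < d 1 h)%N by lia.
pose Tr := [seq (phi 1, phi v, phi w) | v <- B, w <- B].
have [di [X [sX diM di_opp opp_di badX]]] := KP Tr.
rewrite size_allpairs in sX.
have [c [c0 cn geoc]] := exists_geodesic gS 1 h.
pose middle t := (P + 8 * delta + 2 + 3 * delta <= 2 * t)%N &&
   (P + 8 * delta + 2 + 3 * delta + 2 * t <= 2 * d 1 h)%N.
have middleP t : middle t -> [/\ (t <= d 1 h)%N, d 1 (c t) = t, d (c t) h = (d 1 h - t)%N
    & gp (c t) 1 h = 0%N].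
  move=> /andP[m1 m2]; have th : (t <= d 1 h)%N by lia.
  have c1 : d 1 (c t) = t by have := geoc 0%N t ltac:(lia); rewrite c0; lia.
  have c2 : d (c t) h = (d 1 h - t)%N by have := geoc t (d 1 h) ltac:(lia); rewrite cn.
  by split=> //; have := gpE gS (c t) 1 h; rewrite (distC gS _ 1) c1 c2; lia.
pose li N t := (g ^+ N)^-1 * g ^+ t.
have li_step N t : li N t.+1 = li N t * g by rewrite /li expgSr mulgA.
have li_neg t n : li (t + n)%N t = g^-1 ^+ n by rewrite /li expgnDr invgM mulgVK expVgn.
have li_pos N n : li N (N + n)%N = g ^+ n by rewrite /li expgnDr mulKg.
pose YY := [seq phi v * y | v <- BD, y <- X].
have hit t : middle t -> exists2 y, y \in YY & exists N s, y = (phi (li N s))^-1 * c t.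
  move=> mt; have [th xt xh xgp] := middleP t mt; case/andP: (mt) => m1 m2.
  set x := c t in xt xh xgp *; pose p := di x 1; pose p' := di x h.
  have opp : (4 * delta < d p p')%N by apply: opp_di => //; rewrite ?xh ?(distC gS x 1) ?xt; lia.
  have pp' : p != p' by apply/eqP => e; rewrite e distxx // in opp.
  pose al u v := crossing p p' (di x (phi u)) (di x (phi v)).
  have cross_opp a b : crossing p p' a b != 0%R -> (4 * delta < d a b)%N.
    by move=> /crossing_neq0[[-> ->]|[-> ->]] //; rewrite (distC gS).
  (* By equivariance a triple of images at [u] seen from [x] is a triple of [Tr] seen from
     [(phi u)^-1 * x], so closedness fails at [u] only if that point is in [X]. *)
  pose Pl := [seq psi (x * y^-1) | y <- X].
  have sPl : (size Pl <= k)%N by rewrite size_map.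
  have inPl u : (phi u)^-1 * x \in X -> u \in Pl.
    by move=> uX; apply/mapP; exists ((phi u)^-1 * x); rewrite // invgM invgK mulVKg phiK.
  have [bnd bndP] := seq_bound S (map phi B).
  have [s sP] := ball_finite gS (t + J + bnd); have [n nP] := seq_bound S (map psi s).
  (* The bound [n] depends on [phi], which [path_sum] permits: it fixes [D] before the support. *)
  have supp u v : (d u v <= rho)%N -> al u v != 0%R -> (d 1 u <= n)%N.
    move=> uv /cross_opp/di_opp small; apply: nP; apply/mapP; exists (phi u); rewrite ?phiK //.
    apply: sP; rewrite -(dist1 S).
    have : (d 1 (phi (u^-1 * v)%g) <= bnd)%N by apply: bndP; apply: map_f; apply: BP.
    rewrite phiM phiV -(dist_mul S (phi u)) mulg1 mulVKg => h2.
    have := gpE gS x (phi u) (phi v); have := dist_tri gS 1 x (phi u).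
    by have := dist_tri gS x (phi v) (phi u); rewrite (distC gS (phi v)) xt; lia.
  have closed u : u \notin Pl -> closed_at S al rho u.
    move=> uPl v w uv uw vw; apply: crossing_closed => ne1 ne2 ne3.
    have diV y : di ((phi u)^-1 * x) (phi (u^-1 * y)) = (phi u)^-1 * di x (phi y).
      by rewrite phiM phiV diM.
    have noopp : ~ [\/ (4 * delta < d (di x (phi u)) (di x (phi v)))%N,
        (4 * delta < d (di x (phi u)) (di x (phi w)))%N
      | (4 * delta < d (di x (phi v)) (di x (phi w)))%N].
      move=> o; case/negP: uPl; apply: inPl.
      apply: (badX (phi 1) (phi (u^-1 * v)) (phi (u^-1 * w))).
      - by apply: allpairs_f; apply: BP.
      - by rewrite -(mulVg u) !diV => /mulgI.
      - by rewrite -(mulVg u) !diV => /mulgI.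
      - by rewrite !diV => /mulgI.
      - by rewrite -(mulVg u) !diV !dist_mul.
    by split; apply/eqP; apply: contraT => /cross_opp o; case: noopp;
      [apply: Or31|apply: Or33|apply: Or32].
  have [n' zero] := sumD al Pl n sPl (fun u v => crossing_anti _ _ _ _) supp closed.
  have hproper (f : nat -> G) : (forall n, (n <= d 1 (phi (f n)))%N) -> proper_seq S f.
    move=> fn b; have [s' s'P] := ball_finite gS b; have [b' b'P] := seq_bound S (map phi s').
    exists b'.+1 => i ib; rewrite leqNgt; apply/negP => /ltnW lt.
    have := b'P (phi (f i)) (map_f _ (s'P _ _)); rewrite -(dist1 S) => /(_ lt).
    by have := fn i; lia.
  have pg : proper_seq S (fun n => g ^+ n).
    by apply: hproper => i; rewrite phiX; apply: (axis_proper gS hyp i _ axis).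
  have pgV : proper_seq S (fun n => g^-1 ^+ n).
    apply: hproper => i; rewrite expVgn phiV (dist1 S) (word_lengthV gS) -(dist1 S) phiX.
    exact: (axis_proper gS hyp i _ axis).
  have [s' s'P] := ball_finite gS n'.
  have [N0 lN] := @one_ended_linked _ _ gS s' _ _ 2 oe pgV pg
    (fun n => ltac:(by rewrite dist_expg_step dist1 word_lengthV // -dist1))
    (fun n => ltac:(by rewrite dist_expg_step)).
  pose N := N0.+1; have {}lN := lN N N (leqW (leqnn _)) (leqW (leqnn _)).
  apply: contrapT => nohit.
  have := zero (li N) (N + N)%N _ _ _.
  (* The only crossing is at the step from 1 to [g], whose images are seen in the directions [p] and
     [p']. *)
  have sum1 : (\sum_(i < N + N) al (li N i) (li N i.+1) = 1)%R.
    have NN : (N < N + N)%N by rewrite /N; lia.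
    rewrite (bigD1 (Ordinal NN)) //= big1 ?addr0.
      have -> : li N N = 1 by rewrite -{2}(addn0 N) li_pos expg0.
      have -> : li N N.+1 = g by rewrite -addn1 li_pos expg1.
      by rewrite /al phi1 -/h -/p -/p' /crossing !eqxx (eq_sym p' p) (negPf pp') andbF subr0.
    move=> [i iNN]; rewrite -val_eqE /= => iN; apply/eqP; apply: contraT => /cross_opp/di_opp.
    have [lt|gt] := ltnP i N.
      have [n1 NE] : exists n1, N = (i + n1.+1)%N by exists (N - i.+1)%N; lia.
      have -> : li N i = g^-1 ^+ n1.+1 by rewrite NE li_neg.
      have -> : li N i.+1 = g^-1 ^+ n1 by rewrite NE -addSnnS li_neg.
      rewrite !phiX phiV -/h ltnNge => /negP[].
      exact: (axis_backward gS hyp n1 erefl axis xt xh th m1).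
    have [n1 iE] : exists n1, i = (N + n1.+1)%N by exists (i - N.+1)%N; lia.
    rewrite iE -addnS !li_pos !phiX -/h ltnNge => /negP[].
    by apply: (axis_forward gS hyp n1 erefl axis xt xh th); rewrite -/P; lia.
  rewrite sum1 => H; suff : (1 = 0 :> int)%R by [].
  apply: H.
  - by move=> i _; rewrite li_step dist_mulr.
  - move=> i q _ /mapP[y yX ->]; rewrite ltnNge; apply/negP => close; apply: nohit.
    set q' := psi _ in close; exists (phi ((li N i)^-1 * q') * y).
      by apply: allpairs_f => //; apply: BDP.
    exists N, i; rewrite phiM phiV psiK -!mulgA mulVg mulg1 //.
  - have -> : li N 0%N = g^-1 ^+ N by rewrite -(li_neg 0%N).
    have -> : li N (N + N)%N = g ^+ N by rewrite li_pos.
    apply: linked_sub lN => z; rewrite ltnNge; apply: contra; rewrite (dist1 S); exact: s'P.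
(* A translate of a middle point separates [h ^+ n.+1] from [h ^+ n.+2], whereas both are in the
   same direction from a middle point of the first segment. So distinct positions give distinct
   elements of [YY]. *)
have no_translate t1 t2 n : middle t1 -> middle t2 -> c t1 <> h ^+ n.+1 * c t2.
  move=> mt1 mt2 e; have [th1 xt1 xh1 _] := middleP _ mt1; have [_ _ _ x2gp] := middleP _ mt2.
  case/andP: mt1 => _ m2.
  have := axis_forward gS hyp n erefl axis xt1 xh1 th1 ltac:(rewrite -/P; lia).
  have e1 : gp (c t1) (h ^+ n.+1) (h ^+ n.+2) = 0%N.
    by rewrite e -[RHS]x2gp -[RHS](gp_mul S (h ^+ n.+1)) mulg1 -expgSr.
  by rewrite e1; lia.
pose t0 := ((P + 8 * delta + 2 + 3 * delta).+1)./2.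
have mid s : (s <= m)%N -> middle (t0 + s)%N by move=> sm; apply/andP; rewrite /t0; split; lia.
have /choice[F FP] : forall s, exists y, (s <= m)%N -> y \in YY /\
    exists N i, y = (phi (li N i))^-1 * c (t0 + s)%N.
  move=> s; have [sm|] := leqP s m; last by exists 1.
  by have [y yY yE] := hit _ (mid s sm); exists y.
have Finj s s' : (s <= m)%N -> (s' <= m)%N -> F s = F s' -> s = s'.
  move=> sm sm' e; have [_ [N [i Fs]]] := FP s sm; have [_ [N' [i' Fs']]] := FP s' sm'.
  move: e; rewrite Fs Fs' /li !phiM !phiV !phiX -/h !invgM !invgK => e.
  have {}e : h ^+ (i' + N) * c (t0 + s)%N = h ^+ (i + N') * c (t0 + s')%N.
    have := congr1 (mulg (h ^+ (i + i'))) e.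
    rewrite {1}(addnC i i') !expgnDr -!mulgA !mulVKg //.
  have [lt|lt|ee] := ltngtP (i' + N) (i + N').
  - exfalso; apply: (@no_translate (t0 + s)%N (t0 + s')%N (i + N' - (i' + N).+1)%N); rewrite ?mid //.
    by apply: (mulgI (h ^+ (i' + N))); rewrite e mulgA -expgnDr; congr (h ^+ _ * _); lia.
  - exfalso; apply: (@no_translate (t0 + s')%N (t0 + s)%N (i' + N - (i + N').+1)%N); rewrite ?mid //.
    by apply: (mulgI (h ^+ (i + N'))); rewrite -e mulgA -expgnDr; congr (h ^+ _ * _); lia.
  move: e; rewrite ee => /mulgI/(congr1 (d 1)).
  by have [_ -> _ _] := middleP _ (mid s sm); have [_ -> _ _] := middleP _ (mid s' sm') => /addnI.
have uF : uniq [seq F s | s <- iota 0 m.+1].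
  rewrite map_inj_in_uniq ?iota_uniq // => s s'; rewrite !mem_iota => sm sm'.
  by apply: Finj; lia.
have sub : {subset [seq F s | s <- iota 0 m.+1] <= YY}.
  by move=> y /mapP[s]; rewrite mem_iota => sm ->; have [] := FP s ltac:(lia).
have := uniq_leq_size uF sub; rewrite size_map size_iota size_allpairs ltnNge.
by rewrite leq_mul2l sX orbT.
Qed.

End TranslationBound.

Lemma bigmax_attained (T : eqType) (F : T -> nat) (s : seq T) :
  (\max_(x <- s) F x != 0)%N -> exists2 x, x \in s & F x = (\max_(x <- s) F x)%N.
Proof.
elim: s => [|x s IH]; first by rewrite big_nil.
rewrite big_cons; have [le _|lt _] := leqP (\max_(y <- s) F y) (F x).
  by exists x; rewrite ?mem_head.
have [|y ys yE] := IH; first by case: (\max_(y <- s) F y)%N lt.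
by exists y; rewrite // inE ys orbT.
Qed.

(** * Outer automorphisms *)

Section Displacement.
Variables (G : groupType) (S : seq G).
Hypothesis gS : generating S.
Variables (delta : nat) (hyp : hyp4 S delta).
Local Notation d := (dist S).
Local Notation gp := (gp2 S).

Lemma dist1V1 (a : G) : d 1 a^-1 = d 1 a.
Proof. by rewrite !dist1 word_lengthV. Qed.

Lemma dist1_mul (a b : G) : d 1 (a * b) = d a^-1 b.
Proof. by rewrite -(dist_mul S a a^-1) mulgV. Qed.

Lemma dist1_conj (a w : G) : d 1 (a ^ w) = d w (a * w).
Proof. by rewrite -(dist_mul S w 1) mulg1 conjgE mulVKg. Qed.

(** A coarse form of Serre's lemma on trees: if [a], [b] and [a * b] are nearly elliptic, their
    fixed points can be shared, so geodesics from 1 to [a] and to [b] begin together for about half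
    the shorter one. *)
Lemma aligned K (a b : G) :
  (d 1 (a * a)%g <= d 1 a + K)%N -> (d 1 (b * b)%g <= d 1 b + K)%N ->
  (d 1 ((a * b) * (a * b))%g <= d 1 (a * b)%g + K)%N ->
  (minn (d 1 a) (d 1 b) <= gp 1 a b + (K + 4 * delta))%N.
Proof.
move=> aa bb abab; rewrite leqNgt; apply/negP => far.
have ga := gpE gS 1 a^-1 a; rewrite dist1V1 -dist1_mul in ga.
have gb := gpE gS 1 b^-1 b; rewrite dist1V1 -dist1_mul in gb.
have h1 := hyp 1 a a^-1 b; rewrite (gpC gS 1 a a^-1) in h1.
have h2 := hyp 1 b b^-1 a; rewrite (gpC gS 1 b b^-1) (gpC gS 1 b a) in h2.
have ab := gpE gS 1 a^-1 b; rewrite dist1V1 -dist1_mul in ab.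
have g2 := gpE gS 1 (a * b)^-1 (a * b); rewrite dist1V1 -(dist1_mul (a * b)) in g2.
have e1 : gp 1 a (a * b) = gp a^-1 1 b by rewrite -(gp_mul S a a^-1) mulgV mulg1.
have s1 := gp_swap gS 1 a^-1 b; rewrite dist1V1 in s1.
have e2 : gp 1 b^-1 (a * b)^-1 = gp b 1 a^-1.
  by rewrite -(gp_mul S b^-1 b) mulVg mulg1 invgM.
have s2 := gp_swap gS 1 b a^-1; rewrite (gpC gS 1 b a^-1) in s2.
have h3 := hyp 1 b^-1 (a * b)^-1 a.
have h4 := hyp 1 (a * b)^-1 (a * b) a; rewrite (gpC gS 1 (a * b) a) in h4.
rewrite e1 e2 in h3 h4; lia.
Qed.

(** As the square of [a] is not long, [a] and its inverse begin alike, so conjugating by an initial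
    segment shortens [a] at both ends. *)
Lemma shorten K (a w : G) :
  (d 1 (a * a)%g <= d 1 a + K)%N -> (2 * d 1 w <= gp 1 w a + delta)%N ->
  (2 * d 1 w + K <= d 1 a)%N -> (d 1 (a ^ w) + 2 * d 1 w <= d 1 a + 4 * delta)%N.
Proof.
move=> aa wa big.
rewrite dist1_conj.
have ga := gpE gS 1 a^-1 a; rewrite dist1V1 -dist1_mul in ga.
have h1 := hyp 1 w a a^-1; rewrite (gpC gS 1 a a^-1) in h1.
have waV := gpE gS 1 w a^-1; rewrite dist1V1 in waV.
have aw1 : d w a^-1 = d 1 (a * w) by rewrite dist1_mul (distC gS).
have aw : d a (a * w) = d 1 w by rewrite dist_mulr.
have := gpE gS 1 a (a * w); have := gpE gS 1 w (a * w); have := hyp 1 w a (a * w).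
have := dist_tri gS 1 (a * w) a; rewrite (distC gS (a * w) a).
have q0 : (2 * d 1 w <= gp 1 a^-1 a)%N by lia.
have q1 : (2 * d 1 w <= gp 1 w a^-1 + 2 * delta)%N by lia.
have q2 : (d 1 (a * w)%g + d 1 w <= d 1 a + 2 * delta)%N by lia.
lia.
Qed.

Lemma generator_length s : s \in S -> (d 1 s <= 1)%N.
Proof.
move=> sS; rewrite dist1; apply: (word_length_le gS (w := [:: s])); split.
  by move=> x; rewrite inE => /eqP ->; rewrite mem_cat sS.
by rewrite big_cons big_nil mulg1.
Qed.

(** At a conjugate of least displacement, a large displacement would align all long generators with
    an initial segment [w] of the longest one, and conjugation by [w] would shorten them all. The
    length [l] makes the gain [2 * l] exceed the error [4 * delta]; short generators grow by at most
    [2 * l]. *)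
Lemma bounded_representative K : (forall phi : G -> G,
  automorphism phi ->
  forall g, (d 1 g <= 2)%N -> (d 1 (phi g * phi g)%g <= d 1 (phi g) + K)%N) ->
  exists L, forall phi : G -> G, automorphism phi ->
  exists z, forall s, s \in S -> (d 1 (phi s ^ z) <= L)%N.
Proof.
move=> bound; pose l := (2 * delta + 1)%N; pose K' := (K + 4 * delta)%N.
exists (4 * l + K')%N => phi phi_aut.
pose disp z := (\max_(s <- S) d 1 (phi s ^ z))%N.
have exd : exists n, `[< exists z, disp z = n >] by exists (disp 1); apply/asboolP; exists 1.
have [m /asboolP[z dz] minz] := ex_minnP exd.
exists z => s0 s0S; rewrite leqNgt; apply/negP => long.
pose psi (x : G) : G := phi x ^ z.
have [psiM psi_bij] : automorphism psi by apply: automorphism_conj.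
have F := bound psi (conj psiM psi_bij).
have psi_le s : s \in S -> (d 1 (psi s) <= m)%N.
  by move=> sS; rewrite -dz; apply: (leq_bigmax_seq s).
have big : (4 * l + K' < m)%N by apply: leq_trans long (psi_le s0 s0S).
have [s1 s1S s1m] : exists2 s, s \in S & d 1 (psi s) = m.
  have [|s sS sE] := @bigmax_attained G (fun s => d 1 (psi s)) S.
    by rewrite -/(disp z) dz; lia.
  by exists s; rewrite // sE -dz.
have [|w [w1 wa]] := @dist_split _ _ gS 1 (psi s1) l; first by rewrite s1m; lia.
have gw : gp 1 w (psi s1) = (2 * l)%N by have := gpE gS 1 w (psi s1); lia.
have gen2 s t : s \in S -> t \in S -> (d 1 (s * t)%g <= 2)%N.
  move=> /generator_length s1' /generator_length t1'.
  by have := dist_tri gS 1 s (s * t); rewrite dist_mulr; lia.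
have shift s : s \in S -> (d 1 (phi s ^ (z * w)) < m)%N.
  move=> sS; rewrite conjgM -/(psi s); have sm := psi_le s sS.
  have ss : (d 1 (psi s * psi s)%g <= d 1 (psi s) + K)%N.
    by apply: F; have := generator_length sS; lia.
  have [small|large] := ltnP (d 1 (psi s)) (2 * l + K').
    have := dist_tri gS w 1 (psi s * w); have := dist_tri gS 1 (psi s) (psi s * w).
    by rewrite dist1_conj dist_mulr (distC gS w 1) w1; lia.
  have al : (minn (d 1 (psi s1)) (d 1 (psi s)) <= gp 1 (psi s1) (psi s) + K')%N.
    apply: aligned ss _; first by apply: F; have := generator_length s1S; lia.
    by rewrite -psiM; apply: F; apply: gen2.
  have h := hyp 1 w (psi s1) (psi s).
  have := @shorten K (psi s) w ss; rewrite w1 => sh.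
  by have := sh ltac:(lia) ltac:(lia); rewrite /l; lia.
have : (m <= disp (z * w)%g)%N by apply: minz; apply/asboolP; exists (z * w).
rewrite leqNgt => /negP; apply; rewrite /disp.
have m0 : (0 < m)%N by lia.
rewrite -(prednK m0) ltnS; apply/bigmax_leqP_seq => s sS _.
by rewrite -ltnS (prednK m0) shift.
Qed.

End Displacement.

Lemma automorphism_determined (G : groupType) (S : seq G) (phi psi : G -> G) :
  generating S -> {morph phi : x y / x * y} -> {morph psi : x y / x * y} ->
  {in S, phi =1 psi} -> phi =1 psi.
Proof.
move=> gS phiM psiM eqS.
move=> g; have [w [sw <-]] := gS g; elim: w sw => [|x w IHw] sw.
  by rewrite big_nil !morph1.
rewrite big_cons phiM psiM IHw => [|y yw]; last by rewrite sw // inE yw orbT.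
congr (_ * _); have := sw x (mem_head _ _); rewrite mem_cat => /orP[/eqS //|/mapP[s sS ->]].
by rewrite !morphV // eqS.
Qed.

(** Composing with an inner automorphism does not change the coset, so a coset is determined by a
    tuple of elements of one finite ball. *)
Lemma finite_Out (G : groupType) (S : seq G) L : generating S ->
  (forall phi : G -> G, automorphism phi ->
    exists z, forall s, s \in S -> (dist S 1 (phi s ^ z) <= L)%N) ->
  finite_set (Out G).
Proof.
move=> gS rep; have [B BP] := ball_finite gS L.
pose P (v : seq G) (A : set (G -> G)) := exists psi, [/\ automorphism psi,
  [seq psi s | s <- S] = v & A = [set i \o psi | i in @inner G]%classic].
have /choice[F FP] : forall v, exists A, forall A', P v A' -> A' = A.
  move=> v; have [[A [psi [[psiM _] psiv _]]]|no] := EM (exists A, P v A); last first.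
    by exists set0 => A' PA'; case: no; exists A'.
  exists [set i \o psi | i in @inner G]%classic => A' [psi' [[psi'M _] psi'v ->]].
  suff -> : psi' = psi by [].
  apply/funext; apply: (automorphism_determined gS) => // s sS.
  by have /eq_in_map := etrans psi'v (esym psiv); apply.
apply: (@sub_finite_set _ _ ((fun t : (size S).-tuple 'I_(size B) => F [seq nth 1 B (i : 'I__) | i <- t]) @` setT)%classic);
  last exact/finite_image/finite_finset.
move=> A [phi phi_aut <-]; have [z zP] := rep phi phi_aut.
pose psi (x : G) : G := phi x ^ z.
have [psiM psi_bij] : automorphism psi by apply: automorphism_conj.
have psiB s : s \in S -> (index (psi s) B < size B)%N.
  by move=> sS; rewrite index_mem; apply: BP; rewrite -(dist1 S); apply: zP.
have [t tE] : exists t : (size S).-tuple 'I_(size B), [seq nth 1 B (i : 'I__) | i <- t] = [seq psi s | s <- S].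
  have [t tE] : exists t : seq 'I_(size B), [seq nth 1 B (i : 'I__) | i <- t] = [seq psi s | s <- S].
    elim: (S) psiB => [|s S' IH] sB; first by exists [::].
    have [|t tE] := IH; first by move=> u uS'; apply: sB; rewrite inE uS' orbT.
    exists (Ordinal (sB s (mem_head _ _)) :: t); rewrite /= tE nth_index //.
    by rewrite -index_mem; apply: sB; rewrite mem_head.
  have st : size t == size S by rewrite -(size_map (fun i : 'I__ => nth 1 B i)) tE size_map.
  by exists (Tuple st).
exists t => //=; apply/esym/FP; exists psi; split=> //.
rewrite eqEsubset; split=> f [i [c _ <-] <-] /=.
  exists (fun x => x ^ (z^-1 * c)); first by exists (z^-1 * c).
  by apply/funext => x; rewrite /psi /= -conjgM mulVKg.
exists (fun x => x ^ (z * c)); first by exists (z * c).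
by apply/funext => x; rewrite /psi /= -conjgM.
Qed.

Theorem corollary1p3 (G : groupType) :
  hyperbolic_group G -> residually_finite G -> geometrically_rigid G ->
  finite_set (Out G).
Proof.
move=> [S' [gS' /(hyp4_gromov_hyperbolic gS')[delta' hyp']]] rf [S [gS oe nocut]].
have [delta hyp] := hyp4_change gS' gS hyp'.
have [c [xi [dxi gxi gxixi]]] := directions gS hyp oe.
have esc := escape gS hyp dxi gxixi.
have con := connect gS hyp nocut dxi gxi gxixi.
have [K bound] := translation_bound gS hyp oe rf esc con.
have [L rep] := bounded_representative gS hyp bound.
exact: finite_Out gS rep.
Qed.
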